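(* Let $\mathrm C_2^{\mathrm{Lie}}$ be the cumulative convergence radius of the Baker--Campbell--Hausdorff expansion in the Banach--Lie setting, $$\mathrm C^{\mathrm{Lie}}_2=\sup\Big\{ x\in[0,+\infty)\,:\,\max_{0\leq x_1,x_2,\ x_1+x_2\leq x} \Gamma^{\mathrm{Lie}}(x_1,x_2) <+\infty \Big\},$$ and let $\boldsymbol v_{\mathrm{Mi}}=\min_{\delta\in(0,1)}\frac{\arccos\delta}{\sqrt{1-\delta^2}}\cdot 2\sqrt{1+\delta^2}$. Then $$2.93<\mathrm C_2^{\mathrm{Lie}}\le 2\boldsymbol v_{\mathrm{Mi}}=5.4028570\ldots .$$
   Context: A Lie monomial is an iterated bracket of generators (the generators themselves included). For an element $P$ of the free Lie algebra over $\mathbb R$ generated by $Y_1,Y_2$, $$\|P\|_{\ell^1}=\inf\Big\{\sum_j|\theta_j| : P=\sum_j\theta_jM_j \text{ (finite sum)},\ \theta_j\in\mathbb R,\ M_j \text{ Lie monomials}\Big\}.$$ Let $\mathrm{BCH}(Y_1,Y_2)=\log(\exp(Y_1)\exp(Y_2))$ as a formal series of Lie polynomials, and let $\mathrm{BCH}_{n_1,n_2}(Y_1,Y_2)$ be its component homogeneous of degree $n_1$ in $Y_1$ and of degree $n_2$ in $Y_2$. For $x_1,x_2\ge0$ put $$\Gamma^{\mathrm{Lie}}(x_1,x_2)=\sum_{n_1+n_2\ge1}\|\mathrm{BCH}_{n_1,n_2}(Y_1,Y_2)\|_{\ell^1}\,x_1^{n_1}x_2^{n_2}\in[0,+\infty].$$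 The function $\delta\mapsto \frac{\arccos\delta}{\sqrt{1-\delta^2}}\cdot 2\sqrt{1+\delta^2}$ on $(0,1)$ attains its minimum at $\delta_{\mathrm{Mi}}=0.55088194\ldots$, the solution of $\frac{2\delta\arccos\delta}{(1+\delta^2)\sqrt{1-\delta^2}}=1$ in $(0,1)$; numerically $\boldsymbol v_{\mathrm{Mi}}=2.7014285\ldots$. *)

(* Defs.v *)
From HB Require Import structures.
From mathcomp Require Import all_boot all_order all_algebra.
From mathcomp Require Import all_classical all_reals all_analysis.

Set Implicit Arguments.
Unset Strict Implicit.
Unset Printing Implicit Defensive.

Import Order.TTheory GRing.Theory Num.Theory.
Local Open Scope classical_set_scope.
Local Open Scope ring_scope.

(* Noncommutative formal power series in two variables Y_1, Y_2: a word over
   {false, true} encodes a monomial (false for Y_1, true for Y_2), and a series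
   is the function giving the coefficient of each word. *)
Definition word := seq bool.

Section NoncommutativeSeries.
Variable R : realType.
Implicit Types f g : word -> R.

Definition nc_var (a : bool) : word -> R := fun w => (w == [:: a])%:R.

Definition nc_one : word -> R := fun w => (w == [::])%:R.

Definition nc_mul f g : word -> R :=
  fun w => \sum_(i < (size w).+1) f (take i w) * g (drop i w).

Definition nc_pow f (k : nat) : word -> R := iter k (nc_mul f) nc_one.

(* exp f = sum_k f^k / k!, for f without constant term: f^k then vanishes on
   words of length < k, so cutting the sum at k = size w loses nothing. *)
Definition nc_exp f : word -> R :=
  fun w => \sum_(0 <= k < (size w).+1) (k`!%:R)^-1 * nc_pow f k w.

(* log f = sum_(k >= 1) (-1)^(k+1) (f - 1)^k / k, for f with constant term 1;
   the sum is cut for the same reason. *)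
Definition nc_log f : word -> R :=
  fun w => \sum_(1 <= k < (size w).+1)
    (-1) ^+ k.+1 / k%:R * nc_pow (fun u => f u - nc_one u) k w.

Definition BCH : word -> R :=
  nc_log (nc_mul (nc_exp (nc_var false)) (nc_exp (nc_var true))).

Definition BCH_comp (n1 n2 : nat) : word -> R :=
  fun w => if (count_mem false w == n1) && (count_mem true w == n2)
           then BCH w else 0.

End NoncommutativeSeries.

Inductive bracketing : Type :=
| Gen of bool
| Bracket of bracketing & bracketing.

Section LieNorm.
Variable R : realType.

(* The free Lie algebra on Y_1, Y_2 is realized as the Lie subalgebra of the
   free associative algebra generated by the variables (Magnus, Witt). *)
Fixpoint lie_monomial (t : bracketing) : word -> R :=
  match t with
  | Gen a => @nc_var R a
  | Bracket s t => fun w => nc_mul (lie_monomial s) (lie_monomial t) w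
                            - nc_mul (lie_monomial t) (lie_monomial s) w
  end.

(* P = sum_j theta_j M_j, the finite family being the list of the pairs
   (theta_j, M_j). *)
Definition lie_decomposition (P : word -> R) (s : seq (R * bracketing)) : Prop :=
  forall w, P w = \sum_(p <- s) p.1 * lie_monomial p.2 w.

(* Extended-real valued: +oo if P is not a Lie polynomial. *)
Definition lie_norm (P : word -> R) : \bar R :=
  ereal_inf [set (\sum_(p <- s) `|p.1|)%:E | s in lie_decomposition P].

Definition GammaLie (x1 x2 : R) : \bar R :=
  \esum_(n in [set n : nat * nat | (1 <= n.1 + n.2)%N])
    (lie_norm (@BCH_comp R n.1 n.2) * (x1 ^+ n.1 * x2 ^+ n.2)%:E)%E.

(* The maximum is taken in [0, +oo], as a supremum. *)
Definition GammaLie_max (x : R) : \bar R :=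
  ereal_sup [set GammaLie p.1 p.2 |
    p in [set p : R * R | [/\ 0 <= p.1, 0 <= p.2 & p.1 + p.2 <= x]]].

(* Extended-real valued, so that an unbounded set has supremum +oo. *)
Definition C2Lie : \bar R :=
  ereal_sup [set x%:E | x in [set x : R | 0 <= x /\ (GammaLie_max x < +oo)%E]].

Definition Mi_fun (d : R) : R :=
  acos d / Num.sqrt (1 - d ^+ 2) * (2 * Num.sqrt (1 + d ^+ 2)).

Definition v_Mi : R := inf [set Mi_fun d | d in `]0, 1[].

End LieNorm.

(* Main.v *)
(* Lower bound. The series W = log (exp (Y/2) exp X exp (Y/2)) is conjugate to the BCH
   series Z by exp (Y/2), which only costs a factor exp (x2/2) in norm. If D is the derivation
   counting the letter Y, then D W = (ad W / 2) coth (ad W / 2) Y, and W = X in degree 0.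
   Hence the norms of the Y-homogeneous components of W are bounded by the Taylor coefficients
   of the solution of u' = 2 - (u/2) cot (u/2), u(0) = x1. This u exists up to time x2 as soon
   as x1 + x2 is smaller than the time needed to go from 0 to 2 pi, which is about 3.25.
   Upper bound. If Gamma (x, x) is finite, then the BCH series converges at all A, B in sl_2(R)
   of norm at most x, for a Euclidean norm with |[A, B]| <= |A| |B|; so exp A exp B = exp Z
   with Z real and traceless, and its trace is at least -2. For A = s (J + d K) and
   B = s (J - d K) that trace drops below -2 as soon as cos (s sqrt (1 - d^2)) < d, that is,
   when the norm 2 s sqrt (1 + d^2) exceeds Mi_fun d.
   Numerics. With u = (2 acos d)^2, the inequality 2 Mi_fun d >= B amounts to
   cos (sqrt u) (B^2 + 4 u) >= B^2 - 12 u, and cos is replaced by its Taylor polynomials. *)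
From HB Require Import structures.
Require Import Defs.
From mathcomp Require Import all_boot all_order all_algebra.
From mathcomp Require Import all_classical all_reals all_analysis.
From mathcomp Require Import ring lra zify finmap.

Set Implicit Arguments.
Unset Strict Implicit.
Unset Printing Implicit Defensive.

Import Order.TTheory GRing.Theory Num.Theory.
Import numFieldNormedType.Exports.
Local Open Scope classical_set_scope.
Local Open Scope ring_scope.

(** Conjugating by exp (Y/2) is what makes the constant reachable. For the BCH series itself the
    same derivation gives t / (1 - exp (- t)) at t = ad Z, whose linear term t / 2 leads to u' = 2 +
    u/2 - (u/2) cot (u/2), and the comparison stops near 2.17; for W the series is even. Convergence
    of noncommutative series is never discussed: identities hold word by word, and the
    decompositions of W are finite lists produced by Picard iteration, whose weights are polynomials
    in x2. For the upper bound no matrix exponential is formed either. The relation exp Z = exp X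
    exp Y is evaluated in each degree; the traces of truncations of both sides become polynomials in
    a variable marking the degree. They agree up to degree N, their tails are uniformly small, and
    they are compared at 1. The bound -2 already holds for truncations, because an odd number of
    Taylor terms stays above cos. *)

(* An alias is needed: the canonical ring structure on [word -> R] is the pointwise one. *)
Definition ncs (R : realType) := word -> R.
HB.instance Definition _ (R : realType) := GRing.Lmodule.copy (ncs R) (word -> R).

(** * The algebra of noncommutative power series *)

Section NcsRing.
Variable R : realType.
Implicit Types f g h : ncs R.

Lemma ncs_addE f g w : (f + g) w = f w + g w. Proof. by []. Qed.
Lemma ncs_oppE f w : (- f) w = - f w. Proof. by []. Qed.
Lemma ncs_scaleE (c : R) f w : (c *: f) w = c * f w. Proof. by []. Qed.

Lemma nc_mul_nil f g : nc_mul f g [::] = f [::] * g [::].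
Proof. by rewrite /nc_mul big_ord_recl big_ord0 addr0. Qed.

(** Leibniz rule for removing the first letter of a word; it makes induction on words possible. *)
Lemma nc_mul_cons f g x w :
  nc_mul f g (x :: w) = f [::] * g (x :: w) + nc_mul (fun u => f (x :: u)) g w.
Proof. by rewrite /nc_mul /= big_ord_recl. Qed.

Let nc_mulDl f g h : nc_mul (f + g) h = nc_mul f h + nc_mul g h :> ncs R.
Proof.
by apply/funext => w; rewrite fctE /nc_mul -big_split; apply: eq_bigr => i _; rewrite mulrDl.
Qed.

Let nc_mulDr f g h : nc_mul f (g + h) = nc_mul f g + nc_mul f h :> ncs R.
Proof.
by apply/funext => w; rewrite fctE /nc_mul -big_split; apply: eq_bigr => i _; rewrite mulrDr.
Qed.

Let nc_mulZl (c : R) f g : nc_mul (c *: f) g = c *: (nc_mul f g : ncs R).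
Proof.
apply/funext => w; rewrite ncs_scaleE /nc_mul mulr_sumr; apply: eq_bigr => i _.
by rewrite ncs_scaleE mulrA.
Qed.

Let nc_mulZr (c : R) f g : nc_mul f (c *: g) = c *: (nc_mul f g : ncs R).
Proof.
apply/funext => w; rewrite ncs_scaleE /nc_mul mulr_sumr; apply: eq_bigr => i _.
by rewrite ncs_scaleE mulrCA.
Qed.

Let nc_mulA f g h : nc_mul f (nc_mul g h) = nc_mul (nc_mul f g) h.
Proof.
apply/funext => w; elim: w f => [|x w IH] f; first by rewrite !nc_mul_nil mulrA.
rewrite !nc_mul_cons IH nc_mul_nil mulrDr mulrA -addrA; congr (_ + _).
rewrite (_ : (fun u => nc_mul f g (x :: u)) = (f [::] *: ((fun u => g (x :: u)) : ncs R)) +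
   (nc_mul (fun u => f (x :: u)) g : ncs R)); last first.
  by apply/funext => u; rewrite nc_mul_cons.
by rewrite nc_mulDl nc_mulZl.
Qed.

Let nc_mul1 f : nc_mul (@nc_one R) f = f.
Proof.
apply/funext => -[|x w]; first by rewrite nc_mul_nil mul1r.
rewrite nc_mul_cons mul1r /nc_mul big1 ?addr0 // => i _.
by rewrite mul0r.
Qed.

Let nc_mulr1 f : nc_mul f (@nc_one R) = f.
Proof.
apply/funext => w; elim: w f => [|x w IH] f; first by rewrite nc_mul_nil mulr1.
by rewrite nc_mul_cons mulr0 add0r IH.
Qed.

Let nc_one_neq0 : (@nc_one R : ncs R) != 0.
Proof. by apply/eqP => /(congr1 (fun f => f [::])) /eqP; rewrite /= oner_eq0. Qed.

HB.instance Definition _ := GRing.Zmodule_isNzRing.Build (ncs R)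
  nc_mulA nc_mul1 nc_mulr1 nc_mulDl nc_mulDr nc_one_neq0.

HB.instance Definition _ := GRing.Lmodule_isLalgebra.Build R (ncs R)
  (fun c f g => esym (nc_mulZl c f g)).
HB.instance Definition _ := GRing.Lalgebra_isAlgebra.Build R (ncs R)
  (fun c f g => esym (nc_mulZr c f g)).

Lemma ncs_mulE f g : nc_mul f g = f * g.
Proof. by []. Qed.

Lemma ncs_oneE : @nc_one R = 1 :> ncs R.
Proof. by []. Qed.

Lemma ncs_powE f k : nc_pow f k = f ^+ k.
Proof. by elim: k => //= k IH; rewrite /nc_pow /= -/(nc_pow f k) IH exprS. Qed.

Lemma ncs_sumE I (r : seq I) (P : pred I) (F : I -> ncs R) w :
  (\sum_(i <- r | P i) F i) w = \sum_(i <- r | P i) F i w.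
Proof. by elim/big_rec2: _ => // i x y _ <-. Qed.

End NcsRing.

(** Regrouping by antidiagonals, as in a Cauchy product: the terms beyond antidiagonal N vanish, so
    the triangle can be completed to a square. *)
Lemma tri_sum (V : zmodType) N (Y : nat -> nat -> V) :
  (forall j i, (N < i + j)%N -> Y j i = 0) ->
  \sum_(k < N.+1) \sum_(j < k.+1) Y j (k - j)%N =
  \sum_(j < N.+1) \sum_(i < N.+1) Y j i.
Proof.
move=> Y0.
rewrite (eq_bigr (fun k : 'I_N.+1 => \sum_(j < N.+1 | (j <= k)%N) Y j (k - j)%N)); last first.
  move=> k _; rewrite (big_ord_widen _ (fun j => Y j (k - j)%N) (ltn_ord k)).
  by apply: eq_bigl => j; rewrite ltnS.
rewrite (exchange_big_dep predT) //=; apply: eq_bigr => j _.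
rewrite -(big_mkord (fun k => j <= k)%N (fun k => Y j (k - j)%N)).
rewrite (big_cat_nat (n := j)) //=; last by rewrite ltnW.
rewrite big_nat_cond big_pred0 ?add0r; last first.
  by move=> i /=; case: (ltnP i j) => // /[!andbF].
rewrite big_nat_cond (eq_bigl (fun i => j <= i < N.+1)%N); last first.
  by move=> i; case: (leqP j i) => //= _; rewrite andbT.
rewrite -big_nat -{1}(add0n (nat_of_ord j)) big_addn.
rewrite -(big_mkord predT (Y j)) [RHS](big_cat_nat (n := (N.+1 - j)%N)) ?leq_subr //=.
rewrite [X in _ = _ + X]big_nat [X in _ = _ + X]big1 ?addr0; last first.
  by move=> i /andP[h _]; apply: Y0; lia.
by apply: eq_bigr => i _; rewrite addnK.
Qed.

(** * Truncation by word length, and the exponential *)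

Section Truncation.
Variable R : realType.
Implicit Types f g h : ncs R.

(** [eqm N] is congruence modulo the power N + 1 of the augmentation ideal, [low n] is membership in
    its power n. Series identities are proved modulo each such power, where all sums are finite. *)
Definition eqm N f g := forall w, (size w <= N)%N -> f w = g w.
Definition low n f := forall w, (size w < n)%N -> f w = 0.

Lemma eqmP f g : (forall N, eqm N f g) -> f = g.
Proof. by move=> H; apply/funext => w; apply: (H (size w)). Qed.

Lemma eqm_refl N f : eqm N f f. Proof. by []. Qed.

Lemma eqm_sym N f g : eqm N f g -> eqm N g f.
Proof. by move=> H w Hw; rewrite H. Qed.

Lemma eqm_trans N f g h : eqm N f g -> eqm N g h -> eqm N f h.
Proof. by move=> H1 H2 w Hw; rewrite H1 ?H2. Qed.

Lemma eqmM N f f' g g' : eqm N f f' -> eqm N g g' -> eqm N (f * g) (f' * g').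
Proof.
move=> Hf Hg w Hw; rewrite -!ncs_mulE /nc_mul; apply: eq_bigr => i _.
by rewrite Hf ?Hg // (leq_trans _ Hw) // ?size_drop ?leq_subr // size_take_min geq_minr.
Qed.

Lemma eqmX N f g k : eqm N f g -> eqm N (f ^+ k) (g ^+ k).
Proof. by move=> H; elim: k => // k IH; rewrite !exprS; apply: eqmM. Qed.

Lemma eqmZ N (c : R) f g : eqm N f g -> eqm N (c *: f) (c *: g).
Proof. by move=> H w Hw; rewrite !ncs_scaleE H. Qed.

Lemma eqmB N f f' g g' : eqm N f f' -> eqm N g g' -> eqm N (f - g) (f' - g').
Proof. by move=> Hf Hg w Hw; rewrite !ncs_addE !ncs_oppE Hf ?Hg. Qed.

Lemma eqm_sum N I (r : seq I) (P : pred I) (F G : I -> ncs R) :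
  (forall i, P i -> eqm N (F i) (G i)) ->
  eqm N (\sum_(i <- r | P i) F i) (\sum_(i <- r | P i) G i).
Proof. by move=> H w Hw; rewrite !ncs_sumE; apply: eq_bigr => i /H; apply. Qed.

Lemma lowM m n f g : low m f -> low n g -> low (m + n) (f * g).
Proof.
move=> Hf Hg w Hw; rewrite -ncs_mulE /nc_mul big1 // => i _.
case: (ltnP i m) => him.
  by rewrite Hf ?mul0r // (leq_ltn_trans _ him) // size_take_min geq_minl.
by rewrite Hg ?mulr0 // size_drop; have := ltn_ord i; lia.
Qed.

Lemma lowX f k : low 1 f -> low k (f ^+ k).
Proof. by move=> H; elim: k => // k IH; rewrite exprS -add1n; apply: lowM. Qed.

Lemma lowZ n (c : R) f : low n f -> low n (c *: f).
Proof. by move=> H w Hw; rewrite ncs_scaleE H ?mulr0. Qed.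

Lemma lowB n f g : low n f -> low n g -> low n (f - g).
Proof. by move=> Hf Hg w Hw; rewrite !ncs_addE !ncs_oppE Hf // Hg // subr0. Qed.

Lemma lowN n f : low n f -> low n (- f).
Proof. by move=> Hf w Hw; rewrite !ncs_oppE Hf // oppr0. Qed.

Lemma low1P f : f [::] = 0 -> low 1 f.
Proof. by move=> H [|x w]. Qed.

Lemma eqm_tri N (X : nat -> nat -> ncs R) :
  (forall j i, low (i + j) (X j i)) ->
  eqm N (\sum_(k < N.+1) \sum_(j < k.+1) X j (k - j)%N)
        (\sum_(j < N.+1) \sum_(i < N.+1) X j i).
Proof.
move=> H w Hw.
rewrite !ncs_sumE; under eq_bigr do rewrite ncs_sumE.
under [RHS]eq_bigr do rewrite ncs_sumE.
by apply: (@tri_sum _ _ (fun j i => X j i w)) => j i h; apply: H; apply: leq_ltn_trans h.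
Qed.

(** [nc_exp], [nc_log] and [opser] cut their sum at the length of each word; since the terms have
    growing order, one common cut serves all words of length at most N. *)
Lemma eqm_ser (a : nat -> ncs R) N M : (forall k, low k (a k)) -> (N <= M)%N ->
  eqm N (fun w => \sum_(k < (size w).+1) a k w) (\sum_(k < M.+1) a k).
Proof.
move=> H NM w Hw; rewrite ncs_sumE.
rewrite -(big_mkord predT (fun k => a k w)) -(big_mkord predT (fun k => a k w)).
rewrite [RHS](big_cat_nat (n := (size w).+1)) //=; last by rewrite ltnS; lia.
rewrite [X in _ + X]big_nat [X in _ + X]big1 ?addr0 // => i /andP[h _].
by apply: H.
Qed.

Definition nexp f : ncs R := nc_exp f.

Definition expt N f : ncs R := \sum_(k < N.+1) (k`!%:R)^-1 *: f ^+ k.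

Lemma exp_eqm f N M : low 1 f -> (N <= M)%N -> eqm N (nexp f) (expt M f).
Proof.
move=> Hf NM; apply: eqm_trans (eqm_ser (a := fun k => (k`!%:R)^-1 *: f ^+ k) _ NM).
  by move=> w _; rewrite /nexp /nc_exp big_mkord; apply: eq_bigr => k _; rewrite ncs_powE.
by move=> k; apply/lowZ/lowX.
Qed.

Lemma fact_neq0 k : (k`!%:R : R) != 0.
Proof. by rewrite pnatr_eq0 -lt0n fact_gt0. Qed.

Lemma nexp0 : nexp (0 : ncs R) = 1.
Proof.
apply: eqmP => N; apply: eqm_trans (exp_eqm _ (leqnn N)) _ => //.
rewrite /expt big_ord_recl big1 => [|i _]; last first.
  by rewrite lift0 exprS mul0r scaler0.
by rewrite addr0 fact0 invr1 scale1r expr0.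
Qed.

Lemma nexpD f g : low 1 f -> low 1 g -> f * g = g * f ->
  nexp (f + g) = nexp f * nexp g.
Proof.
move=> Hf Hg C; apply: eqmP => N.
apply: eqm_trans (exp_eqm (N := N) _ (leqnn N)) _.
  by move=> w Hw; rewrite ncs_addE Hf // Hg // addr0.
apply: eqm_trans _ (eqmM (eqm_sym (exp_eqm Hf (leqnn N))) (eqm_sym (exp_eqm Hg (leqnn N)))).
rewrite /expt mulr_suml; under [X in eqm _ _ X]eq_bigr do rewrite mulr_sumr.
apply: eqm_trans (eqm_tri (X := fun j i => ((j`!%:R)^-1 *: f ^+ j) * ((i`!%:R)^-1 *: g ^+ i)) _).
  suff H : forall k, (k`!%:R)^-1 *: (f + g) ^+ k =
    \sum_(j < k.+1) ((j`!%:R)^-1 *: f ^+ j) * (((k - j)`!%:R)^-1 *: g ^+ (k - j)).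
    by rewrite (eq_bigr _ (fun (k : 'I_N.+1) _ => H k)).
  move=> k; rewrite addrC (exprDn_comm _ (esym C)) scaler_sumr; apply: eq_bigr => j _.
  rewrite -scalerAl -scalerAr scalerA -scalerMnr scalerMnl -mulr_natr; congr (_ *: _); last first.
    by apply: commrX; apply: commr_sym; apply: commrX.
  rewrite -(bin_fact (ltnSE (ltn_ord j))) !natrM.
  have hb : 'C(k, j)%:R != 0 :> R by rewrite pnatr_eq0 -lt0n bin_gt0 -ltnS.
  by field; rewrite !fact_neq0 hb.
by move=> j i; rewrite addnC; apply: lowM; apply/lowZ/lowX.
Qed.

Lemma nexpV f : low 1 f -> nexp f * nexp (- f) = 1.
Proof.
by move=> H; rewrite -nexpD ?subrr ?nexp0 // ?mulrN ?mulNr //; apply: lowN.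
Qed.

End Truncation.

(** * The exponential of the logarithm *)

Section ExpLogPoly.
Variable R : realType.

Definition log_poly N : {poly R} := \sum_(k < N) ((-1) ^+ k / k.+1%:R) *: 'X^(k.+1).
Definition exp_log_poly N : {poly R} := \sum_(k < N.+1) (k`!%:R)^-1 *: log_poly N ^+ k.

Lemma log_poly_factor N : {p : {poly R} | log_poly N = 'X * p}.
Proof.
exists (\sum_(k < N) ((-1) ^+ k / k.+1%:R) *: 'X^k).
by rewrite mulr_sumr; apply: eq_bigr => k _; rewrite -scalerAr exprS.
Qed.

Lemma deriv_log_poly N : (1 + 'X) * (log_poly N)^`() = 1 - (- 'X) ^+ N.
Proof.
have -> : (log_poly N)^`() = \sum_(k < N) (- 'X) ^+ k.
  rewrite raddf_sum /=; apply: eq_bigr => k _.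
  rewrite derivZ derivXn /= -scalerMnr scalerMnl -mulr_natr (exprNn 'X).
  by rewrite divfK ?pnatr_eq0 // -signr_odd -[in RHS]signr_odd scaler_sign mulr_sign.
by rewrite -[1 in RHS](expr1n _ N) subrXX opprK addrC; congr (_ * _);
   apply: eq_bigr => k _; rewrite expr1n mul1r.
Qed.

Lemma deriv_exp_log_poly N :
  (exp_log_poly N)^`() =
  (log_poly N)^`() * (exp_log_poly N - (N`!%:R)^-1 *: log_poly N ^+ N).
Proof.
rewrite /exp_log_poly [in RHS]big_ord_recr /= addrK raddf_sum /= big_ord_recl.
rewrite derivZ expr0 -polyC1 derivC scaler0 add0r mulr_sumr; apply: eq_bigr => k _.
rewrite lift0 derivZ deriv_exp /= factS natrM -scalerAr.
rewrite -scalerMnr scalerMnl -mulr_natr; congr (_ *: _).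
by field; rewrite fact_neq0 nat1r pnatr_eq0.
Qed.

(** The truncation E of exp (log (1 + X)) satisfies (1 + X) E' = E modulo X^N, and E(0) = 1.
    Comparing coefficients gives (i + 1) e_(i+1) = (1 - i) e_i, hence e_1 = 1 and zero
    afterwards. *)
Lemma coef_exp_log_poly N i : (i <= N)%N -> (exp_log_poly N)`_i = (i < 2)%:R.
Proof.
have [p1 Hp1] := log_poly_factor N.
have q0 : (exp_log_poly N)`_0 = 1.
  rewrite /exp_log_poly coef_sum big_ord_recl big1 => [|k _]; last first.
    by rewrite lift0 coefZ Hp1 exprS -mulrA coefXM /= mulr0.
  by rewrite addr0 coefZ expr0 coef1 fact0 invr1 mulr1.
elim: i => [|i IH] iN; first by rewrite q0.
have := congr1 (fun q : {poly R} => ((1 + 'X) * q)`_i) (deriv_exp_log_poly N).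
rewrite mulrA deriv_log_poly exprNn.
(* Both error terms contain X^N, because [log_poly] is divisible by X. *)
rewrite [RHS](_ : _ = (exp_log_poly N)`_i); last first.
  rewrite Hp1 exprMn.
  set a := _ *: _; set b := (-1) ^+ N * _.
  rewrite (_ : (1 - b) * _ =  exp_log_poly N +
    (- ((-1) ^+ N) * (exp_log_poly N - a) - (N`!%:R)^-1 *: p1 ^+ N) * 'X^N); last first.
    rewrite /a /b -!mul_polyC; ring.
  by rewrite coefD coefMXn iN addr0.
rewrite mulrDl mul1r coefD coefXM coef_deriv.
case: i iN IH => [|i] iN IH /=; first by rewrite q0 addr0 mulr1n.
rewrite coef_deriv IH ?(ltnW iN) //.
case: i iN IH => [|i] iN IH /=.
  rewrite mulr1n -[RHS]add0r => /addIr /eqP.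
  by rewrite mulrn_eq0 /= => /eqP ->.
by rewrite mul0rn addr0 => /eqP; rewrite mulrn_eq0 /= => /eqP ->.
Qed.

End ExpLogPoly.

Section ExpLog.
Variable R : realType.
Implicit Types f g h : ncs R.

Definition nlog f : ncs R := nc_log f.

Lemma horner_alg_low_eqm N f (q : {poly R}) : low 1 f -> (forall i, (i <= N)%N -> q`_i = (i < 2)%:R) ->
  eqm N (horner_alg f q) (1 + f).
Proof.
move=> Hf Hq w Hw.
have -> : q = \sum_(i < (N.+2 + size q)%N) q`_i *: 'X^i.
  rewrite -(poly_def _ (fun i => q`_i)); apply/polyP => i; rewrite coef_poly.
  by case: ltnP => // h; apply: nth_default; apply: leq_trans h; rewrite leq_addl.
rewrite linear_sum ncs_sumE /=.
rewrite -(big_mkord predT (fun i => horner_alg f (q`_i *: 'X^i) w)).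
have Hi i : horner_alg f (q`_i *: 'X^i) w = q`_i * (f ^+ i) w.
  by rewrite linearZ /= rmorphXn /= horner_algX mulr_algl ncs_scaleE.
rewrite (big_cat_nat (n := 2)) //= [X in _ + X]big_nat [X in _ + X]big1 ?addr0; last first.
  move=> i /andP[h _]; rewrite Hi; case: (leqP i N) => iN.
    by rewrite Hq // ltnNge h mul0r.
  by rewrite (lowX (k := i) Hf) ?mulr0 //; apply: leq_ltn_trans iN.
rewrite big_nat_recl // big_nat1 !Hi expr0 expr1 ncs_addE Hq // mul1r; congr (_ + _).
(* For N = 0 nothing is known about the coefficient of index 1, but only the empty word remains and
   f vanishes there. *)
case: N Hq Hw => [|N] Hq Hw; last by rewrite Hq ?mul1r.
by case: w Hw Hi => // _ _; rewrite Hf // mulr0.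
Qed.

Lemma nlog_eqm f N M : low 1 (f - 1) -> (N <= M)%N ->
  eqm N (nlog f) (horner_alg (f - 1) (log_poly R M)).
Proof.
move=> Hf NM; set F := f - 1.
(* The coefficient of index 0 is x / 0 = 0, so the sum may start at 0. *)
pose a k := ((-1) ^+ k.+1 / k%:R : R) *: F ^+ k.
have Ha k : low k (a k) by apply/lowZ/lowX.
have -> : horner_alg F (log_poly R M) = \sum_(k < M.+1) a k.
  rewrite big_ord_recl {1}/a invr0 mulr0 scale0r add0r linear_sum.
  apply: eq_bigr => k _; rewrite lift0 linearZ /= rmorphXn /= horner_algX mulr_algl /a.
  by rewrite [in RHS]exprS [in RHS]exprS !mulN1r opprK.
apply: eqm_trans (eqm_ser Ha NM) => w _.
rewrite /nlog /nc_log -(big_mkord predT (fun k => a k w)) /= [RHS]big_ltn //=.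
rewrite [X in _ = X + _](_ : _ = 0) ?add0r; last by rewrite /a invr0 mulr0 scale0r.
by apply: eq_bigr => k _; rewrite (ncs_powE F).
Qed.

Lemma nlog_low f : low 1 (nlog f).
Proof. by apply: low1P; rewrite /nlog /nc_log big_geq. Qed.

(** [horner_alg] at f - 1 is a ring morphism from one-variable polynomials, so modulo long words
    this reduces to [coef_exp_log_poly]. *)
Lemma nlogK f : f [::] = 1 -> nexp (nlog f) = f.
Proof.
move=> Hf; have HF : low 1 (f - 1).
  by apply: low1P; rewrite ncs_addE ncs_oppE Hf subrr.
apply: eqmP => N; apply: eqm_trans (exp_eqm (nlog_low f) (leqnn N)) _.
apply: (eqm_trans (g := horner_alg (f - 1) (exp_log_poly R N))).
  rewrite linear_sum; apply: eqm_sum => k _; rewrite linearZ /= rmorphXn /= mulr_algl.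
  by apply/eqmZ/eqmX/nlog_eqm.
apply: eqm_trans (horner_alg_low_eqm HF (@coef_exp_log_poly R N)) _.
by rewrite addrC subrK.
Qed.

End ExpLog.

(** * Derivations and exponentials *)

Section Ad.
Variable A : nzRingType.
Implicit Types f g : A.

Definition ad f g := f * g - g * f.
Definition adn f k g := iter k (ad f) g.

Lemma adnS f k g : adn f k.+1 g = ad f (adn f k g). Proof. by []. Qed.
Lemma adnD f j k g : adn f (j + k) g = adn f j (adn f k g).
Proof. by rewrite /adn iterD. Qed.

Lemma mul_ad f g : f * g = ad f g + g * f.
Proof. by rewrite /ad subrK. Qed.

(** Left multiplication by f is the sum of ad f and of right multiplication by f, which commute:
    this is their binomial formula. *)
Lemma exprM_ad f n g :
  f ^+ n * g = \sum_(k < n.+1) adn f k g * f ^+ (n - k) *+ 'C(n, k).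
Proof.
elim: n => [|n IH]; first by rewrite big_ord_recl big_ord0 /= !expr0 mul1r mulr1 bin0 addr0.
rewrite exprS -mulrA IH mulr_sumr.
rewrite (eq_bigr (fun k : 'I_n.+1 => adn f k.+1 g * f ^+ (n - k) *+ 'C(n, k) +
   adn f k g * f ^+ (n.+1 - k) *+ 'C(n, k))); last first.
  move=> k _; rewrite adnS mulrnAr mulrA {1}(mul_ad f) mulrDl mulrnDl -mulrA -exprS subSn //.
  by rewrite -ltnS.
rewrite big_split /= [RHS]big_ord_recl.
under [X in _ = _ + X]eq_bigr do rewrite lift0 binS subSS mulrnDr.
rewrite [X in _ = _ + X]big_split /= [RHS]addrA [RHS]addrC; congr (_ + _).
rewrite big_ord_recl /= !bin0; congr (_ + _).
by rewrite [RHS]big_ord_recr /= bin_small ?mulr0n ?addr0.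
Qed.

End Ad.

Section Derivation.
Variable R : realType.
Implicit Types f g h W : ncs R.

Definition nvar (a : bool) : ncs R := nc_var R a.

Definition der f : ncs R := fun w => (count_mem true w)%:R * f w.

Lemma derZ (c : R) f : der (c *: f) = c *: der f.
Proof. by apply/funext => w; rewrite /der !ncs_scaleE mulrCA. Qed.

Lemma der_sum I (r : seq I) (P : pred I) (F : I -> ncs R) :
  der (\sum_(i <- r | P i) F i) = \sum_(i <- r | P i) der (F i).
Proof.
apply/funext => w; rewrite /der !ncs_sumE mulr_sumr.
by apply: eq_bigr.
Qed.

Lemma derM f g : der (f * g) = der f * g + f * der g.
Proof.
apply/funext => w; rewrite ncs_addE /der -!ncs_mulE /nc_mul mulr_sumr -big_split /=.
apply: eq_bigr => i _; rewrite -{1}(cat_take_drop i w) count_cat natrD.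
by rewrite mulrDl mulrA [_%:R * (_ * _)]mulrCA.
Qed.

Lemma der1 : der 1 = 0.
Proof. by have := derM 1 1; rewrite !mulr1 mul1r => h; apply: (addIr (der 1)); rewrite add0r -h. Qed.

Lemma eqm_der N f g : eqm N f g -> eqm N (der f) (der g).
Proof. by move=> H w Hw; rewrite /der H. Qed.

Lemma derX f n :
  der (f ^+ n) = \sum_(k < n) adn f k (der f) * f ^+ (n.-1 - k) *+ 'C(n, k.+1).
Proof.
elim: n => [|n IH]; first by rewrite expr0 der1 big_ord0.
rewrite exprSr derM exprM_ad IH mulr_suml.
under [RHS]eq_bigr do rewrite binS mulrnDr /=.
rewrite [RHS]big_split /=; congr (_ + _).
rewrite [RHS]big_ord_recr /= bin_small // mulr0n addr0; apply: eq_bigr => k _.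
rewrite mulrnAl -mulrA -exprSr; congr (_ * _ ^+ _ *+ _).
by case: n k {IH} => [[]|n k] //=; rewrite subSn // -ltnS.
Qed.

Lemma low_ad n m f g : low n f -> low m g -> low (n + m) (ad f g).
Proof. by move=> Hf Hg; apply: lowB; [apply: lowM | rewrite addnC; apply: lowM]. Qed.

Lemma low_adn f k m g : low 1 f -> low m g -> low (k + m) (adn f k g).
Proof. by move=> Hf Hg; elim: k => // k IH; rewrite adnS addSn -add1n; apply: low_ad. Qed.

(** The power series with coefficients c in the operator ad f, applied to g. When f has no constant
    term, ad f raises the order and the cut loses nothing. *)
Definition opser (c : nat -> R) f g : ncs R :=
  fun w => \sum_(k < (size w).+1) (c k *: adn f k g) w.

Lemma low_opser_term c f g k : low 1 f -> low k (c k *: adn f k g).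
Proof.
move=> H; apply: lowZ; have h : low 0 g by [].
by move: (@low_adn f k 0 g H h); rewrite addn0.
Qed.

Lemma opser_eqm c f g N M : low 1 f -> (N <= M)%N ->
  eqm N (opser c f g) (\sum_(k < M.+1) c k *: adn f k g).
Proof.
by move=> Hf; apply: (eqm_ser (a := fun k => c k *: adn f k g)) => k; apply: low_opser_term.
Qed.

Lemma adn_sum f n I (r : seq I) (F : I -> ncs R) :
  adn f n (\sum_(i <- r) F i) = \sum_(i <- r) adn f n (F i).
Proof.
elim: n => // n IH; rewrite adnS IH /ad mulr_sumr mulr_suml -sumrB.
by apply: eq_bigr.
Qed.

Lemma adnZ f n (c : R) g : adn f n (c *: g) = c *: adn f n g.
Proof. by elim: n => // n IH; rewrite !adnS IH /ad -scalerAr -scalerAl -scalerBr. Qed.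

Lemma adnB f n g h : adn f n (g - h) = adn f n g - adn f n h.
Proof.
elim: n => // n IH; rewrite !adnS IH /ad mulrBr mulrBl !opprB.
by rewrite [X in _ + X]addrC addrACA; congr (_ + _); rewrite addrC.
Qed.

Lemma eqm_adn N k f f' g g' : eqm N f f' -> eqm N g g' -> eqm N (adn f k g) (adn f' k g').
Proof. by move=> Hf Hg; elim: k => // k IH; rewrite !adnS; apply: eqmB; apply: eqmM. Qed.

(** Duhamel's formula, with the operator (exp t - 1) / t at t = ad f. It follows from [derX] and
    C(k+1, j+1) / (k+1)! = 1 / ((j+1)! (k-j)!). *)
Lemma der_exp f : low 1 f ->
  der (nexp f) = opser (fun k => (k.+1`!%:R)^-1) f (der f) * nexp f.
Proof.
move=> Hf; apply: eqmP => N.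
(* One more term is kept, since [der] kills the term of index 0. *)
apply: eqm_trans (eqm_der (exp_eqm Hf (leqnSn N))) _.
apply: eqm_trans _ (eqm_sym (eqmM (opser_eqm _ _ Hf (leqnn N)) (exp_eqm Hf (leqnn N)))).
rewrite /expt mulr_suml; under [X in eqm _ _ X]eq_bigr do rewrite mulr_sumr.
pose X j i : ncs R := ((j.+1`!%:R)^-1 *: adn f j (der f)) * ((i`!%:R)^-1 *: f ^+ i).
apply: (eqm_trans (g := \sum_(k < N.+1) \sum_(j < k.+1) X j (k - j)%N)); last first.
  apply: eqm_tri => j i; rewrite addnC; apply: lowM; last exact/lowZ/lowX.
  exact: (low_opser_term (fun k => (k.+1`!%:R)^-1) _ Hf).
rewrite der_sum big_ord_recl derZ expr0 der1 scaler0 add0r.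
apply: eqm_sum => k _; rewrite lift0 derZ derX scaler_sumr; apply: eqm_sum => j _.
rewrite /X -scalerAl -scalerAr scalerA -scalerMnr scalerMnl -mulr_natr /=.
suff -> : (k.+1`!%:R)^-1 * 'C(k.+1, j.+1)%:R = (j.+1`!%:R)^-1 * ((k - j)`!%:R)^-1 :> R by [].
rewrite -(bin_fact (ltn_ord j)) subSS 2!natrM.
have hb : 'C(k.+1, j.+1)%:R != 0 :> R by rewrite pnatr_eq0 -lt0n bin_gt0.
move: hb (fact_neq0 R j.+1) (fact_neq0 R (k - j)).
move: ('C(_, _)%:R : R) (j.+1`!%:R : R) ((k - j)`!%:R : R) => x y z hx hy hz.
by field; rewrite hx hy hz.
Qed.

(** This is Ad (exp f) = exp (ad f). *)
Lemma exp_mul_ad f g : low 1 f ->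
  nexp f * g = opser (fun k => (k`!%:R)^-1) f g * nexp f.
Proof.
move=> Hf; apply: eqmP => N.
apply: eqm_trans (eqmM (exp_eqm Hf (leqnn N)) (@eqm_refl _ _ _)) _.
apply: eqm_trans _ (eqm_sym (eqmM (opser_eqm _ _ Hf (leqnn N)) (exp_eqm Hf (leqnn N)))).
rewrite /expt mulr_suml; rewrite mulr_suml; under [X in eqm _ _ X]eq_bigr do rewrite mulr_sumr.
pose X j i : ncs R := ((j`!%:R)^-1 *: adn f j g) * ((i`!%:R)^-1 *: f ^+ i).
apply: (eqm_trans (g := \sum_(k < N.+1) \sum_(j < k.+1) X j (k - j)%N)); last first.
  apply: eqm_tri => j i; rewrite addnC; apply: lowM; last exact/lowZ/lowX.
  exact: (low_opser_term (fun k => (k`!%:R)^-1) _ Hf).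
apply: eqm_sum => k _; rewrite -scalerAl exprM_ad scaler_sumr; apply: eqm_sum => j _.
rewrite /X -scalerAl -scalerAr scalerA -scalerMnr scalerMnl -mulr_natr /=.
suff -> : (k`!%:R)^-1 * 'C(k, j)%:R = (j`!%:R)^-1 * ((k - j)`!%:R)^-1 :> R by [].
rewrite -(bin_fact (ltnSE (ltn_ord j))) !natrM.
have hb : 'C(k, j)%:R != 0 :> R by rewrite pnatr_eq0 -lt0n bin_gt0 -ltnS.
by field; rewrite !fact_neq0 hb.
Qed.

Lemma opser_comp (a b c : nat -> R) f g : low 1 f ->
  (forall n, \sum_(j < n.+1) a j * b (n - j)%N = c n) ->
  opser a f (opser b f g) = opser c f g.
Proof.
move=> Hf Hc; apply: eqmP => N.
apply: eqm_trans (opser_eqm _ _ Hf (leqnn N)) _.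
apply: eqm_trans _ (eqm_sym (opser_eqm _ _ Hf (leqnn N))).
pose X j i : ncs R := (a j * b i) *: adn f (j + i) g.
apply: (eqm_trans (g := \sum_(j < N.+1) \sum_(i < N.+1) X j i)).
  apply: eqm_sum => j _.
  apply: (eqm_trans (eqmZ _ (eqm_adn j (@eqm_refl _ _ f) (opser_eqm b g Hf (leqnn N))))).
  rewrite adn_sum scaler_sumr; apply: eqm_sum => i _.
  by rewrite adnZ scalerA -adnD.
apply: eqm_trans (eqm_sym (eqm_tri _)) _.
  by move=> j i; rewrite addnC /X; apply: (low_opser_term (fun=> a j * b i) _ Hf).
apply: eqm_sum => k _; rewrite -Hc scaler_suml; apply: eqm_sum => j _.
by rewrite /X subnKC // -ltnS.
Qed.

(** The operator is the identity plus terms that raise the order, so the part of lowest order of g -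
    h cannot be cancelled. *)
Lemma opser_inj (a : nat -> R) f g h : low 1 f -> a 0%N = 1 ->
  opser a f g = opser a f h -> g = h.
Proof.
move=> Hf a0 E.
suff H n : low n (g - h).
  apply/eqP; rewrite -subr_eq0; apply/eqP; apply/funext => w.
  exact: (H (size w).+1).
elim: n => // n IH w Hw.
have : opser a f (g - h) w = 0.
  have -> : opser a f (g - h) = opser a f g - opser a f h.
    apply/funext => u; rewrite ncs_addE ncs_oppE /opser -sumrB; apply: eq_bigr => k _.
    by rewrite adnB scalerBr.
  by rewrite E subrr.
rewrite /opser big_ord_recl a0 scale1r big1 ?addr0 // => k _.
apply: (lowZ (n := k.+1 + n)); last by rewrite addSn ltnS in Hw *; lia.
by apply: low_adn.
Qed.

Lemma nexp_mulI f g h : low 1 f -> g * nexp f = h * nexp f -> g = h.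
Proof.
by move=> Hf /(congr1 (fun x => x * nexp (- f))); rewrite -!mulrA nexpV // !mulr1.
Qed.

End Derivation.

(** * The Taylor coefficients of (x/2) coth (x/2) *)

Section CothCoefficients.
Variable R : realType.

Fixpoint coth_seq n : seq R :=
  if n is m.+1 then
    rcons (coth_seq m) (((m.+1 == 2)%:R / 4 -
      \sum_(1 <= i < m.+1) (coth_seq m)`_i * (coth_seq m)`_(m.+1 - i)) / m.+2%:R)
  else [:: 1].

(* The recursion is read off the Riccati equation x y' = y - y ^ 2 + x ^ 2 / 4. *)
Definition coth_coef : nat -> R := locked (fun n => (coth_seq n)`_n).

Lemma coth_coefE n : coth_coef n = (coth_seq n)`_n. Proof. by rewrite /coth_coef -lock. Qed.

Lemma size_coth_seq n : size (coth_seq n) = n.+1.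
Proof. by elim: n => // n IH; rewrite /= size_rcons IH. Qed.

Lemma nth_coth_seq n i : (i <= n)%N -> (coth_seq n)`_i = coth_coef i.
Proof.
elim: n => [|n IH]; first by rewrite leqn0 => /eqP ->; rewrite coth_coefE.
rewrite leq_eqVlt => /orP[/eqP ->|h]; first by rewrite coth_coefE.
by rewrite /= nth_rcons size_coth_seq h IH.
Qed.

Lemma coth_coef0 : coth_coef 0 = 1. Proof. by rewrite coth_coefE. Qed.

Lemma coth_coefS n : (0 < n)%N ->
  n.+1%:R * coth_coef n =
  (n == 2)%:R / 4 - \sum_(1 <= i < n) coth_coef i * coth_coef (n - i).
Proof.
case: n => // n _; rewrite [in LHS]coth_coefE /= nth_rcons size_coth_seq ltnn eqxx.
rewrite mulrC divfK ?pnatr_eq0 //; congr (_ - _).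
rewrite !big_nat; apply: eq_bigr => i /andP[i0 iN].
by rewrite !nth_coth_seq //; lia.
Qed.

Lemma coef_lt_eq0_factor (p : {poly R}) n : (forall i, (i < n)%N -> p`_i = 0) ->
  exists r, p = r * 'X^n.
Proof.
move=> H; exists (drop_poly n p).
rewrite -{1}(poly_take_drop n p) (_ : take_poly n p = 0) ?add0r //.
by apply/polyP => i; rewrite coef_take_poly coef0; case: ltnP => // /H.
Qed.

(** In generating series: ((exp t - 1) / t) C = (1 + exp t) / 2, which identifies C as (t/2) coth
    (t/2). With P = (exp t - 1) / t, the relation t P' = 1 + (t - 1) P and the Riccati equation for
    C show that Q = P C - 1 - t P / 2 solves the linear equation t Q' = Q (t/2 - C). *)
Lemma coth_coef_conv n :
  \sum_(j < n.+1) (j.+1`!%:R)^-1 * coth_coef (n - j)%N =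
  2^-1 * ((n == 0)%:R + (n`!%:R)^-1).
Proof.
pose C := \poly_(i < n.+1) coth_coef i.
pose P := \poly_(i < n.+1) (i.+1`!%:R : R)^-1.
have [r1 H1] : exists r, 'X * P^`() - (1 + ('X - 1) * P) = r * 'X^(n.+1).
  apply: coef_lt_eq0_factor => i iN.
  rewrite mulrBl mul1r !coefB coefD coefB !coefXM coef1 coef_deriv !coef_poly.
  case: i iN => [|i] iN /=; first by rewrite (_ : 1`! = 1%N) // invr1; lra.
  rewrite iN (ltnW iN) add0r -mulr_natr [(i.+2)`!]factS natrM.
  have := fact_neq0 R i.+1; move: (_%:R : R) => x hx.
  by field; rewrite hx -natr1 -natr1 /=; apply/eqP; have : (0:R) <= i%:R by []; lra.
have [r2 H2] : exists r, 'X * C^`() - (C - C ^+ 2 + 4^-1 *: 'X^2) = r * 'X^(n.+1).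
  apply: coef_lt_eq0_factor => i iN.
  rewrite expr2 coefB coefD coefB coefXM coefM coefZ coefXn coef_deriv !coef_poly iN.
  rewrite (eq_bigr (fun j : 'I_i.+1 => coth_coef j * coth_coef (i - j))); last first.
    move=> j _; rewrite !coef_poly !ifT //; have := ltn_ord j; lia.
  case: i iN => [|i] iN /=; first by rewrite big_ord1 coth_coef0; lra.
  rewrite iN big_ord_recl big_ord_recr /= !coth_coef0 subn0 subnn coth_coef0 mul1r mulr1.
  have := coth_coefS (ltn0Sn i); rewrite -(big_mkord predT (fun j => coth_coef (bump 0 j) * coth_coef (i.+1 - bump 0 j))).
  rewrite big_add1 /= -[_ *+ i.+1]mulr_natr -natr1.
  have -> : \sum_(0 <= j < i) coth_coef j.+1 * coth_coef (i.+1 - j.+1) =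
    \sum_(0 <= j < i) coth_coef (bump 0 j) * coth_coef (i.+1 - bump 0 j) by [].
  by move: (\sum_(_ <= _ < _) _) => S; rewrite [in X in _ -> X]mulrC; lra.
(* As C has constant term 1, the coefficient i of the equation expresses (i + 1) q_i through earlier
   coefficients of Q, so Q vanishes. *)
have aux (Q r : {poly R}) : 'X * Q^`() - Q * (2^-1 *: 'X - C) = r * 'X^(n.+1) ->
    forall i, (i <= n)%N -> Q`_i = 0.
  move=> HQ i.
  elim/ltn_ind: i => i IH iN.
  have := congr1 (fun q : {poly R} => q`_i) HQ.
  rewrite coefMXn ltnS iN coefB coefXM coef_deriv mulrBr coefB -scalerAr coefZ coefMX.
  rewrite coefM big_ord_recr /= subnn big1 ?add0r; last first.
    by move=> j _; rewrite IH ?mul0r //; have := ltn_ord j; lia.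
  rewrite coef_poly /= coth_coef0 mulr1.
  case: i IH iN => [|i] IH iN /=; first by lra.
  rewrite (IH i) ?(ltnW iN) // -mulr_natr -natr1.
  by have : (0:R) <= i%:R by []; nra.
pose Q := P * C - 1 - 2^-1 *: ('X * P).
have [r HQ] : exists r, 'X * Q^`() - Q * (2^-1 *: 'X - C) = r * 'X^(n.+1).
  exists (C * r1 + P * r2 - 2^-1 *: ('X * r1)).
  have E1 : 'X * P^`() = 1 + ('X - 1) * P + r1 * 'X^(n.+1) by rewrite -H1; ring.
  have E2 : 'X * C^`() = C - C ^+ 2 + 4^-1 *: 'X^2 + r2 * 'X^(n.+1) by rewrite -H2; ring.
  have -> : 'X * Q^`() = ('X * P^`()) * C + P * ('X * C^`()) - 2^-1 *: ('X * P + 'X * ('X * P^`())).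
    rewrite /Q !derivB derivZ !derivM derivX -!polyC1 derivC -!mul_polyC.
    ring.
  rewrite E1 E2 /Q -!mul_polyC.
  have -> : (4^-1 : R)%:P = (2^-1)%:P * (2^-1)%:P.
    by rewrite -polyCM; congr (_%:P); lra.
  have : (2^-1 : R)%:P + (2^-1)%:P = 1 :> {poly R} by rewrite -polyCD -polyC1; congr (_%:P); lra.
  move: (2^-1)%:P ('X^(n.+1)) => h x hh.
  (* h is the constant 1/2, opaque to [ring]: the relation h + h = 1 enters through this null
     term. *)
  have H0 : (1 - (h + h)) * ('X * P * C - h * 'X ^+ 2 * P) = 0 by rewrite hh subrr mul0r.
  by rewrite -[RHS]add0r -[X in _ = X + _]H0; ring.
have {HQ}Q0 := aux Q r HQ.
have := Q0 n (leqnn n).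
rewrite /Q !coefB coefZ coefXM coef1 coefM coef_poly.
rewrite (eq_bigr (fun j : 'I_n.+1 => (j.+1`!%:R)^-1 * coth_coef (n - j))); last first.
  by move=> j _; rewrite !coef_poly ltn_ord ltnS leq_subr.
case: {C P H1 H2 Q Q0 aux} n => [|n] /=; first by rewrite (_ : 0`! = 1%N) // invr1; lra.
by rewrite ltnW //; lra.
Qed.

End CothCoefficients.

(** * The symmetric BCH series *)

Section SymmetricBCH.
Variable R : realType.
Implicit Types f g h : ncs R.

Let X : ncs R := nvar R false.
Let Y : ncs R := nvar R true.
Let f0 : ncs R := 2^-1 *: Y.

Definition nBCH : ncs R := nlog (nexp X * nexp Y).
(* log (exp (Y/2) exp X exp (Y/2)), as a conjugate of the BCH series. *)
Definition symBCH : ncs R := nexp f0 * nBCH * nexp (- f0).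

Lemma BCHE : @BCH R = nBCH. Proof. by []. Qed.

Lemma low_nvar a : low 1 (nvar R a).
Proof. by apply: low1P; rewrite /nvar /nc_var mulr0n. Qed.

Let low_f0 : low 1 f0. Proof. exact/lowZ/low_nvar. Qed.
Let low_Nf0 : low 1 (- f0). Proof. exact/lowN/low_f0. Qed.

Lemma nexp_nil f : low 1 f -> nexp f [::] = 1.
Proof.
move=> Hf; rewrite (exp_eqm Hf (leqnn 0)) // /expt big_ord1 ncs_scaleE expr0.
by rewrite (_ : 0`! = 1%N) // invr1 mul1r.
Qed.

Lemma nexp_nBCH : nexp nBCH = nexp X * nexp Y.
Proof.
apply: nlogK; rewrite -ncs_mulE nc_mul_nil !nexp_nil ?mulr1 //; exact: low_nvar.
Qed.

Lemma low_nBCH : low 1 nBCH. Proof. exact: nlog_low. Qed.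

Lemma low_symBCH : low 1 symBCH.
Proof.
rewrite /symBCH -mulrA (_ : 1 = 0 + (1 + 0))%N //; apply: lowM => //.
by apply: lowM => //; exact: low_nBCH.
Qed.

Let ad_comm0 f g k : f * g = g * f -> adn f k.+1 g = 0.
Proof.
move=> C; elim: k => [|k IH]; first by rewrite adnS /= /ad C subrr.
by rewrite adnS IH /ad mulr0 mul0r subrr.
Qed.

Lemma opser_comm (c : nat -> R) f g : f * g = g * f -> opser c f g = c 0%N *: g.
Proof.
move=> C; apply/funext => w; rewrite /opser big_ord_recl big1 ?addr0 // => k _.
by rewrite lift0 ad_comm0 // scaler0.
Qed.

Lemma nexp_comm f g : low 1 f -> f * g = g * f -> nexp f * g = g * nexp f.
Proof.
move=> Hf C; rewrite exp_mul_ad // opser_comm // (_ : 0`! = 1%N) // invr1 scale1r //.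
Qed.

Lemma der_exp_comm f : low 1 f -> f * der f = der f * f -> der (nexp f) = der f * nexp f.
Proof.
by move=> Hf C; rewrite der_exp // opser_comm // (_ : 1`! = 1%N) // invr1 scale1r.
Qed.

Lemma der_X : der X = 0.
Proof.
apply/funext => w; rewrite /der /X /nvar /nc_var.
by case: eqP => [->|_]; rewrite ?mul0r ?mulr0.
Qed.

Lemma der_Y : der Y = Y.
Proof.
apply/funext => w; rewrite /der /Y /nvar /nc_var.
by case: eqP => [->|_]; rewrite ?mul1r ?mulr0.
Qed.

Let f0V : nexp f0 * nexp (- f0) = 1. Proof. exact: nexpV. Qed.
Let Vf0 : nexp (- f0) * nexp f0 = 1.
Proof. by rewrite -{2}[f0]opprK nexpV. Qed.

Let expY : nexp Y = nexp f0 * nexp f0.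
Proof. rewrite -nexpD // -scalerDl; congr (nexp _); rewrite [X in X *: _](_ : _ = 1) ?scale1r //; lra. Qed.

Lemma nexp_symBCH : nexp symBCH = nexp f0 * nexp X * nexp f0.
Proof.
transitivity (nexp f0 * nexp nBCH * nexp (- f0)); last first.
  by rewrite nexp_nBCH expY !mulrA -mulrA f0V mulr1.
apply: eqmP => N; apply: eqm_trans (exp_eqm low_symBCH (leqnn N)) _.
apply: eqm_trans _ (eqmM (eqmM (@eqm_refl _ _ _) (eqm_sym (exp_eqm low_nBCH (leqnn N)))) (@eqm_refl _ _ _)).
rewrite /expt mulr_sumr mulr_suml; apply: eqm_sum => k _.
rewrite -scalerAr -scalerAl; apply: eqmZ.
suff -> : symBCH ^+ k = nexp f0 * nBCH ^+ k * nexp (- f0) by [].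
elim: (nat_of_ord k) => [|n IH]; first by rewrite !expr0 mulr1 f0V.
by rewrite exprS IH /symBCH !mulrA -(mulrA _ (nexp (- f0))) Vf0 mulr1 exprS !mulrA.
Qed.

Lemma nBCH_symBCH : nBCH = opser (fun k => (k`!%:R)^-1) (- f0) symBCH.
Proof.
have := exp_mul_ad symBCH low_Nf0.
rewrite {1}/symBCH !mulrA Vf0 mul1r => /(congr1 (fun x => x * nexp f0)).
by rewrite -!mulrA Vf0 !mulr1.
Qed.

(** With f0 = Y/2 one has D f0 = f0 and D X = 0, so D (exp W) = f0 exp W + exp W f0 = ((1 + exp (ad
    W)) f0) exp W. By [der_exp] this is also (exp t - 1) / t at t = ad W, applied to D W, times exp
    W; [coth_coef_conv] is the quotient of the two operators. *)
Lemma der_symBCH : der symBCH = opser (coth_coef R) symBCH Y.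
Proof.
have lW := low_symBCH.
apply: (@opser_inj _ (fun k => (k.+1`!%:R)^-1) symBCH) => //.
  by rewrite (_ : 1`! = 1%N) // invr1.
rewrite (opser_comp Y lW (@coth_coef_conv R)); apply: (nexp_mulI lW).
rewrite -der_exp // nexp_symBCH !derM.
have -> : der (nexp X) = 0 by rewrite der_exp_comm ?der_X ?mul0r ?mulr0 //; exact: low_nvar.
have df0 : der f0 = f0 by rewrite derZ der_Y.
have -> : der (nexp f0) = f0 * nexp f0 by rewrite der_exp_comm ?df0.
rewrite mulr0 addr0 -[in X in _ + X](nexp_comm low_f0 (erefl _)).
rewrite !mulrA -[in X in _ + X]nexp_symBCH exp_mul_ad // nexp_symBCH -!mulrA -mulrDl !mulrA.
congr (_ * _ * _ * _).
apply/funext => w; rewrite ncs_addE.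
have -> : f0 w = \sum_(k < (size w).+1) ((2^-1 * (k == 0%N :> nat)%:R) *: adn symBCH k Y) w.
  rewrite big_ord_recl big1 ?addr0 ?mulr1 // => k _.
  by rewrite lift0 mulr0 scale0r.
rewrite /opser -big_split; apply: eq_bigr => k _ /=.
by rewrite adnZ !ncs_scaleE mulrDr mulrDl; congr (_ + _); rewrite mulrA [_ / 2]mulrC.
Qed.

End SymmetricBCH.

Section InitialValue.
Variable R : realType.
Implicit Types f g h : ncs R.

(** The substitution Y_2 = 0, an endomorphism of the algebra. *)
Definition yfree f : ncs R := fun w => if count_mem true w == 0%N then f w else 0.

Lemma yfreeM f g : yfree (f * g) = yfree f * yfree g.
Proof.
apply/funext => w; rewrite {1}/yfree -!ncs_mulE /nc_mul; case: eqP => H.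
  apply: eq_bigr => i _; rewrite /yfree.
  have : count_mem true (take i w ++ drop i w) = 0%N by rewrite cat_take_drop.
  by rewrite count_cat => /eqP; rewrite addn_eq0 => /andP[-> ->].
rewrite big1 // => i _; rewrite /yfree.
case: eqP => [h1|]; rewrite ?mul0r //; case: eqP => [h2|]; rewrite ?mulr0 //.
by case: H; rewrite -(cat_take_drop i w) count_cat h1 h2.
Qed.

Lemma yfree1 : yfree 1 = 1.
Proof.
apply/funext => w; rewrite /yfree; case: eqP => // H.
by rewrite -ncs_oneE /nc_one; case: eqP H => // ->.
Qed.

Lemma yfree_sum I (r : seq I) (F : I -> ncs R) :
  yfree (\sum_(i <- r) F i) = \sum_(i <- r) yfree (F i).
Proof.
by apply/funext => w; rewrite ncs_sumE /yfree; case: eqP => _; rewrite ?ncs_sumE // big1.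
Qed.

Lemma yfreeZ (c : R) f : yfree (c *: f) = c *: yfree f.
Proof. by apply/funext => w; rewrite ncs_scaleE /yfree; case: eqP => _; rewrite ?mulr0. Qed.

Lemma yfreeX f k : yfree (f ^+ k) = yfree f ^+ k.
Proof. by elim: k => [|k IH]; rewrite ?expr0 ?yfree1 // !exprS yfreeM IH. Qed.

Lemma yfree_low n f : low n f -> low n (yfree f).
Proof. by move=> H w Hw; rewrite /yfree H // if_same. Qed.

Lemma yfree_exp f : low 1 f -> yfree (nexp f) = nexp (yfree f).
Proof.
move=> Hf; apply: eqmP => N.
apply: (eqm_trans (g := yfree (expt N f))).
  by move=> w Hw; rewrite /yfree (exp_eqm Hf (leqnn N)).
apply: eqm_trans _ (eqm_sym (exp_eqm (yfree_low Hf) (leqnn N))).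
by rewrite /expt yfree_sum; apply: eqm_sum => k _; rewrite yfreeZ yfreeX.
Qed.

Lemma low_pow_sub n f g k : low 1 f -> low 1 g -> low n (f - g) ->
  low (n + k) (f ^+ k.+1 - g ^+ k.+1).
Proof.
move=> Hf Hg H; elim: k => [|k IH]; first by rewrite !expr1 addn0.
have -> : f ^+ k.+2 - g ^+ k.+2 = f * (f ^+ k.+1 - g ^+ k.+1) + (f - g) * g ^+ k.+1.
  by rewrite mulrBr mulrBl -!exprS addrA subrK.
move=> w Hw; rewrite ncs_addE (lowM Hf IH) ?(lowM H (lowX (k := k.+1) Hg)) ?addr0 //.
by rewrite add1n -addnS.
Qed.

(** By [low_pow_sub], the part of lowest order of f - g reaches exp f - exp g only through the
    linear term. *)
Lemma nexp_inj f g : low 1 f -> low 1 g -> nexp f = nexp g -> f = g.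
Proof.
move=> Hf Hg E.
suff H n : low n (f - g).
  apply/eqP; rewrite -subr_eq0; apply/eqP; apply/funext => w.
  exact: (H (size w).+1).
elim: n => // n IH w Hw; have [Hw'|Hw'] := ltnP (size w) n; first exact: IH.
have := congr1 (fun u : ncs R => u w) E.
(* The larger cut makes the terms k = 0 and k = 1 exist even for the empty word. *)
rewrite (exp_eqm (N := size w) (M := (size w).+1) Hf) // (exp_eqm (N := size w) (M := (size w).+1) Hg) //.
move/eqP; rewrite -subr_eq0 -ncs_oppE -ncs_addE /expt -sumrB ncs_sumE.
rewrite big_ord_recl big_ord_recl big1; last first.
  move=> k _; rewrite !lift0 -scalerBr ncs_scaleE (low_pow_sub Hf Hg IH) ?mulr0 //; lia.
by rewrite !lift0 !expr0 !expr1 subrr add0r addr0 (_ : 1`! = 1%N) // invr1 !scale1r => /eqP.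
Qed.

Lemma yfree_symBCH : yfree (symBCH R) = nvar R false.
Proof.
have Yf : yfree (2^-1 *: nvar R true) = 0.
  apply/funext => w; rewrite /yfree ncs_scaleE /nvar /nc_var.
  by case: eqP => // H; case: eqP H => [->|_]; rewrite ?mulr0.
have Xf : yfree (nvar R false) = nvar R false.
  apply/funext => w; rewrite /yfree /nvar /nc_var.
  by case: eqP => // H; case: eqP H => // ->.
have lX := @low_nvar R false; have lY : low 1 (2^-1 *: nvar R true) by apply/lowZ/low_nvar.
apply: nexp_inj => //; first exact/yfree_low/low_symBCH.
rewrite -yfree_exp; last exact: low_symBCH.
by rewrite nexp_symBCH !yfreeM !yfree_exp // Yf Xf nexp0 mul1r mulr1.
Qed.

End InitialValue.

(** * Majorants by lists of Lie monomials *)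

Fixpoint deg (b : bool) (t : bracketing) : nat :=
  match t with Gen a => (a == b) | Bracket s t => deg b s + deg b t end.

Section LieLists.
Variable R : realType.
Implicit Types (f g h : ncs R) (s : seq (R * bracketing)).

Definition lm t : ncs R := lie_monomial R t.
#[local] Arguments lm : simpl never.

Lemma lm_bracket t u : lm (Bracket t u) = ad (lm t) (lm u).
Proof. by []. Qed.

Lemma lm_deg t b w : count_mem b w != deg b t -> lm t w = 0.
Proof.
elim: t w => [a|t IHt u IHu] w H.
  rewrite /lm /= /nc_var; case: eqP => // Hw; move: H.
  by rewrite Hw /= addn0 eqxx.
have aux t1 t2 : (forall v, count_mem b v != deg b t1 -> lm t1 v = 0) ->
  (forall v, count_mem b v != deg b t2 -> lm t2 v = 0) ->
  count_mem b w != (deg b t1 + deg b t2)%N -> (lm t1 * lm t2) w = 0.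
  move=> H1 H2 H'; rewrite -ncs_mulE /nc_mul big1 // => i _.
  have [h1|/H1->] := eqVneq (count_mem b (take i w)) (deg b t1); last by rewrite mul0r.
  have [h2|/H2->] := eqVneq (count_mem b (drop i w)) (deg b t2); last by rewrite mulr0.
  by case/negP: H'; rewrite -(cat_take_drop i w) count_cat h1 h2.
rewrite lm_bracket /ad ncs_addE ncs_oppE (aux t u) // (aux u t) ?subrr //.
by rewrite addnC; apply: H.
Qed.

(** A decomposition is carried as an explicit list: its value is compared with the series, and
    independently its weight bounds the norm. *)
Definition evl s : ncs R := \sum_(p <- s) p.1 *: lm p.2.
Definition bracketl s1 s2 : seq (R * bracketing) :=
  [seq (p.1 * q.1, Bracket p.2 q.2) | p <- s1, q <- s2].
Definition scalel (c : R) s : seq (R * bracketing) := [seq (c * p.1, p.2) | p <- s].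
Definition adl k s1 s2 := iter k (bracketl s1) s2.
Definition sumscalel (c : nat -> R) K (F : nat -> seq (R * bracketing)) :=
  flatten [seq scalel (c k) (F k) | k <- iota 0 K].

Lemma evl_bracket s1 s2 : evl (bracketl s1 s2) = ad (evl s1) (evl s2).
Proof.
rewrite /evl /bracketl big_allpairs_dep /= /ad.
rewrite mulr_suml [in X in _ - X]mulr_sumr -sumrB; apply: eq_bigr => p _.
rewrite mulr_sumr mulr_suml -sumrB; apply: eq_bigr => q _.
rewrite lm_bracket /ad scalerBr -!scalerAl -!scalerAr !scalerA; congr (_ - _ *: _).
exact: mulrC.
Qed.

Lemma evl_adl k s1 s2 : evl (adl k s1 s2) = adn (evl s1) k (evl s2).
Proof. by elim: k => // k IH; rewrite /adl iterS evl_bracket IH. Qed.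

Lemma evl_sumscale c K F : evl (sumscalel c K F) = \sum_(k < K) c k *: evl (F k).
Proof.
rewrite /evl /sumscalel big_flatten /= big_map -(big_mkord predT (fun k => c k *: evl (F k))).
rewrite /index_iota subn0; apply: eq_bigr => k _; rewrite /scalel big_map scaler_sumr.
by apply: eq_bigr => p _; rewrite scalerA.
Qed.

Variable a : R.
Hypothesis a_ge0 : 0 <= a.

(** The weight of a list as a polynomial in x2, for x1 = a. Lists are never simplified, so brackets
    become exact products. *)
Definition wpoly s : {poly R} :=
  \sum_(p <- s) (`|p.1| * a ^+ deg false p.2) *: 'X^(deg true p.2).

Lemma wpoly_bracket s1 s2 : wpoly (bracketl s1 s2) = wpoly s1 * wpoly s2.
Proof.
rewrite /wpoly /bracketl big_allpairs_dep /= mulr_suml; apply: eq_bigr => p _.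
rewrite mulr_sumr; apply: eq_bigr => q _.
by rewrite -scalerAl -scalerAr scalerA normrM !exprD mulrACA.
Qed.

Lemma wpoly_adl k s1 s2 : wpoly (adl k s1 s2) = wpoly s1 ^+ k * wpoly s2.
Proof. by elim: k => [|k IH]; rewrite ?mul1r // /adl iterS wpoly_bracket IH exprS mulrA. Qed.

Lemma wpoly_sumscale c K F :
  wpoly (sumscalel c K F) = \sum_(k < K) `|c k| *: wpoly (F k).
Proof.
rewrite /wpoly /sumscalel big_flatten /= big_map -(big_mkord predT (fun k => `|c k| *: wpoly (F k))).
rewrite /index_iota subn0; apply: eq_bigr => k _; rewrite /scalel big_map scaler_sumr.
by apply: eq_bigr => p _; rewrite scalerA normrM mulrA.
Qed.

Lemma coef_wpoly_ge0 s n : 0 <= (wpoly s)`_n.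
Proof.
rewrite coef_sum; apply: sumr_ge0 => p _; rewrite coefZ coefXn.
by rewrite !mulr_ge0 // exprn_ge0.
Qed.

Lemma horner_wpoly s t : (wpoly s).[t] =
  \sum_(p <- s) `|p.1| * a ^+ deg false p.2 * t ^+ deg true p.2.
Proof.
rewrite /wpoly horner_sum; apply: eq_bigr => p _.
by rewrite hornerZ hornerXn.
Qed.

Section Lists.
Variable K : nat.

(** The right-hand side of the differential equation of W, on lists; integrating it repeatedly is
    Picard iteration. *)
Definition derl s := sumscalel (coth_coef R) K (fun k => adl k s [:: (1, Gen true)]).

(* Integration in Y_2; the constant terms disappear because x / 0 = 0. *)
Fixpoint symBCHl j : seq (R * bracketing) :=
  (1, Gen false) ::
  if j is i.+1 then [seq (p.1 / (deg true p.2)%:R, p.2) | p <- derl (symBCHl i)] else [::].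

Definition BCHl j := sumscalel (fun k => (k`!%:R)^-1) K
  (fun k => adl k [:: (- 2^-1, Gen true)] (symBCHl j)).

Lemma wpoly_gen b c : wpoly [:: (c, Gen b)] = if b then `|c| *: 'X else (`|c| * a)%:P.
Proof.
rewrite /wpoly big_seq1; case: b => /=; first by rewrite expr0 mulr1 expr1.
by rewrite expr1 expr0 alg_polyC.
Qed.

Lemma wpoly_derl s : wpoly (derl s) = 'X * \sum_(k < K) `|coth_coef R k| *: wpoly s ^+ k.
Proof.
rewrite wpoly_sumscale mulr_sumr; apply: eq_bigr => k _.
by rewrite wpoly_adl wpoly_gen normr1 scale1r -scalerAr mulrC.
Qed.

Lemma wpoly_symBCHl0 : wpoly (symBCHl 0) = a%:P.
Proof. by rewrite wpoly_gen normr1 mul1r. Qed.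

Lemma coef_wpoly_symBCHl0 j : (wpoly (symBCHl j))`_0 = a.
Proof.
case: j => [|j]; first by rewrite wpoly_symBCHl0 coefC.
rewrite /wpoly [symBCHl _]/= big_cons coefD coefZ coefXn /= normr1 expr1 mul1r mulr1.
rewrite big_map coef_sum big1 ?addr0 // => p _ /=.
rewrite coefZ coefXn; case: eqP => [<-|]; last by rewrite mulr0.
by rewrite invr0 mulr0 normr0 !mul0r.
Qed.

(** The division by the degree cancels against the derivative, so the weights follow Picard
    iteration for u' = sum_(k < K) |c_k| u^k, a partial sum of 2 - (u/2) cot (u/2). *)
Lemma deriv_wpoly_symBCHl j : (wpoly (symBCHl j.+1))^`() =
  \sum_(k < K) `|coth_coef R k| *: wpoly (symBCHl j) ^+ k.
Proof.
apply/polyP => n; rewrite coef_deriv.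
have -> : (\sum_(k < K) `|coth_coef R k| *: wpoly (symBCHl j) ^+ k)`_n =
   (wpoly (derl (symBCHl j)))`_n.+1 by rewrite wpoly_derl coefXM.
rewrite {1}/wpoly [symBCHl _]/= big_cons coefD coefZ coefXn /= mulr0 add0r big_map.
rewrite !coef_sum -mulr_natr mulr_suml; apply: eq_bigr => p _ /=.
rewrite !coefZ !coefXn; case: eqP => [<-|]; last by rewrite !mulr0 mul0r.
by rewrite normrM normfV normr_nat !mulr1 mulrAC [_ / _ * _]mulrAC -mulrA mulfV ?mulr1 // pnatr_eq0.
Qed.

End Lists.
End LieLists.
#[local] Arguments lm : simpl never.

(** * The lists represent the series in low degrees *)

Section Agreement.
Variable R : realType.
Implicit Types (f g h : ncs R).

Definition agree M N f g := forall w,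
  (count_mem false w <= M)%N -> (count_mem true w <= N)%N -> f w = g w.
Definition yvan f := forall w, count_mem true w = 0%N -> f w = 0.

Lemma count_word_size (w : word) : (count_mem false w + count_mem true w)%N = size w.
Proof. by elim: w => //= -[] w <-; lia. Qed.

Lemma count_take_drop b (w : word) i :
  (count_mem b (take i w) + count_mem b (drop i w))%N = count_mem b w.
Proof. by rewrite -count_cat cat_take_drop. Qed.

Lemma agreeM M N f f' g g' : agree M N f f' -> agree M N g g' -> agree M N (f * g) (f' * g').
Proof.
move=> Hf Hg w HX HY; rewrite -!ncs_mulE /nc_mul; apply: eq_bigr => i _.
have h1 := count_take_drop false w i; have h2 := count_take_drop true w i.
by rewrite Hf ?Hg //; lia.
Qed.

Lemma agree_ad M N f f' g g' : agree M N f f' -> agree M N g g' -> agree M N (ad f g) (ad f' g').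
Proof.
by move=> Hf Hg w HX HY; rewrite /ad !ncs_addE !ncs_oppE (agreeM Hf Hg HX HY) (agreeM Hg Hf HX HY).
Qed.

Lemma agree_adn M N k f f' g g' :
  agree M N f f' -> agree M N g g' -> agree M N (adn f k g) (adn f' k g').
Proof. by move=> Hf Hg; elim: k => // k IH; rewrite !adnS; apply: agree_ad. Qed.

Lemma yvan_ad f g : yvan g -> yvan (ad f g).
Proof.
move=> Hg w Hw; rewrite /ad ncs_addE ncs_oppE -!ncs_mulE /nc_mul !big1 ?subrr // => i _;
  have := count_take_drop true w i; rewrite Hw => /eqP; rewrite addn_eq0 => /andP[/eqP h1 /eqP h2].
  by rewrite (Hg (take i w)) ?mul0r.
by rewrite (Hg (drop i w)) ?mulr0.
Qed.

(** Words in the support of g contain the letter Y, which leaves at most N letters Y for f: the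
    bracket gains one degree in Y. *)
Lemma agree_adS M N f f' g g' : yvan g -> agree M N f f' -> agree M N.+1 g g' ->
  agree M N.+1 (ad f g) (ad f' g').
Proof.
move=> Vg Hf Hg w HX HY.
have E (u v : word) : (count_mem false u + count_mem false v <= M)%N ->
    (count_mem true u + count_mem true v <= N.+1)%N -> f u = f' u /\ g v = g' v \/ g v = 0 /\ g' v = 0.
  move=> h1 h2; have gv : g v = g' v by apply: Hg; lia.
  case: (posnP (count_mem true v)) => h; [right | left]; last by split=> //; apply: Hf; lia.
  by rewrite -gv Vg.
rewrite /ad !ncs_addE !ncs_oppE -!ncs_mulE /nc_mul.
congr (_ - _); apply: eq_bigr => i _;
  have h1 := count_take_drop false w i; have h2 := count_take_drop true w i.
- by case: (E (take i w) (drop i w)) => [||[-> ->]|[-> ->]]; rewrite ?h1 ?h2 ?mulr0.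
- by case: (E (drop i w) (take i w)) => [||[-> ->]|[-> ->]]; rewrite ?mul0r // addnC ?h1 ?h2.
Qed.

Lemma agree_adnS M N k f f' g : yvan g -> agree M N f f' ->
  agree M N.+1 (adn f k g) (adn f' k g).
Proof.
move=> Vg Hf.
have Vk n h : yvan (adn h n g) by elim: n => // n IH; rewrite adnS; apply: yvan_ad.
by elim: k => // k IH; rewrite !adnS; apply: agree_adS.
Qed.

Lemma opser_ge_size c f g (w : word) K : low 1 f -> (size w < K)%N ->
  opser c f g w = \sum_(k < K) c k * adn f k g w.
Proof.
case: K => // K Hf Hw; rewrite (opser_eqm c g Hf (N := size w) (M := K)) // ncs_sumE.
by [].
Qed.

Lemma yvan_nvar : yvan (nvar R true).
Proof. by move=> w; rewrite /nvar /nc_var; case: eqP => // ->. Qed.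

Lemma evl1 (c : R) b : evl [:: (c, Gen b)] = c *: nvar R b.
Proof. by rewrite /evl big_seq1. Qed.

(** The operator series is applied to Y, so each Picard step gains one degree in Y. Terms of index K
    or more are harmless, because [adn W k Y] vanishes on words shorter than k. *)
Lemma agree_symBCHl K M j : (M + j < K)%N -> agree M j (symBCH R) (evl (symBCHl R K j)).
Proof.
have yf0 (w : word) : count_mem true w = 0%N -> symBCH R w = nvar R false w.
  by move=> Hw; rewrite -yfree_symBCH /yfree Hw eqxx.
elim: j => [|j IH] HK w HX HY.
  by rewrite evl1 scale1r yf0 //; lia.
rewrite /evl [symBCHl _ _ _]/= big_cons scale1r ncs_addE big_map ncs_sumE /=.
have [h|h] := eqVneq (count_mem true w) 0%N.
  rewrite yf0 // big1 ?addr0 // => p _; rewrite ncs_scaleE.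
  have [hp|hp] := eqVneq (count_mem true w) (deg true p.2); last by rewrite (lm_deg R hp) mulr0.
  by rewrite -hp h invr0 mulr0 mul0r.
have -> : lm R (Gen false) w = 0.
  by rewrite (@lm_deg R _ true) // /= h.
have {}IH : agree M j (symBCH R) (evl (symBCHl R K j)) by apply: IH; lia.
have : (count_mem true w)%:R * symBCH R w = evl (derl K (symBCHl R K j)) w.
  rewrite -[LHS]/(der (symBCH R) w) der_symBCH (@opser_ge_size _ _ _ _ K); first last.
  - by rewrite -count_word_size; lia.
  - exact: low_symBCH.
  rewrite /derl evl_sumscale ncs_sumE; apply: eq_bigr => k _.
  by rewrite evl_adl evl1 scale1r ncs_scaleE (agree_adnS k yvan_nvar IH).
move=> /(congr1 (fun x => (count_mem true w)%:R^-1 * x)).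
rewrite mulKf ?pnatr_eq0 // => ->; rewrite add0r /evl ncs_sumE mulr_sumr.
apply: eq_bigr => p _; rewrite !ncs_scaleE.
have [hp|hp] := eqVneq (count_mem true w) (deg true p.2); last by rewrite (lm_deg R hp) !mulr0.
by rewrite -hp mulrA [_ / _]mulrC.
Qed.

Lemma agree_BCHl K M N : (M + N < K)%N -> agree M N (nBCH R) (evl (BCHl R K N)).
Proof.
move=> HK w HX HY.
rewrite nBCH_symBCH (@opser_ge_size _ _ _ _ K); first last.
- by rewrite -count_word_size; lia.
- by rewrite -scaleNr; apply/lowZ/low_nvar.
rewrite /BCHl evl_sumscale ncs_sumE; apply: eq_bigr => k _; rewrite evl_adl evl1 ncs_scaleE scaleNr.
by rewrite (agree_adn k (fun _ _ _ => erefl) (agree_symBCHl HK)).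
Qed.

End Agreement.

(** * Bounds for the coth coefficients *)

Section CothBounds.
Variable R : realType.
Let c := coth_coef R.

Lemma big_ord_double (V : zmodType) (F : nat -> V) n :
  \sum_(i < n.*2) F i = \sum_(i < n) (F i.*2 + F i.*2.+1).
Proof.
elim: n => [|n IH]; first by rewrite !big_ord0.
by rewrite doubleS !big_ord_recr /= IH addrA.
Qed.

Lemma coth_coef_odd n : odd n -> c n = 0.
Proof.
elim/ltn_ind: n => n IH on.
have n0 : (0 < n)%N by case: n on {IH}.
have := coth_coefS R n0; rewrite big_nat big1 => [|i /andP[i0 iN]].
  case: eqP => [h|_]; first by rewrite h in on.
  by rewrite mul0r subr0 => /eqP; rewrite mulf_eq0 pnatr_eq0 /= => /eqP.
have : odd (i + (n - i)) by rewrite subnKC // ltnW.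
rewrite oddD; case: (boolP (odd i)) => oi /= oni.
  by rewrite -/c IH // mul0r.
by rewrite -/c (IH (n - i)%N) ?mulr0 //; lia.
Qed.

Lemma coth_coef_evenS k : (0 < k)%N -> (k.*2.+1)%:R * c k.*2 =
  (k == 1%N)%:R / 4 - \sum_(1 <= i < k) c i.*2 * c (k - i).*2.
Proof.
case: k => // k _; have := coth_coefS R (ltn0Sn k.*2.+1); rewrite -/c -doubleS => ->.
have -> : (k.+1.*2 == 2) = (k.+1 == 1%N) by rewrite doubleS; case: k.
congr (_ - _); apply: (addrI (c 0%N * c (k.+1.*2 - 0)%N)).
rewrite -big_ltn // big_mkord (big_ord_double (fun i => c i * c (k.+1.*2 - i)%N)).
rewrite -(big_mkord predT (fun i => c i.*2 * c (k.+1.*2 - i.*2)%N + c i.*2.+1 * c (k.+1.*2 - i.*2.+1)%N)).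
rewrite big_ltn //= (coth_coef_odd (n := 1)) // mul0r addr0; congr (_ + _).
apply: eq_bigr => i _; rewrite (coth_coef_odd (n := i.*2.+1)) /= ?odd_double //.
by rewrite mul0r addr0 doubleB.
Qed.

Lemma coth_coef2 : c 2 = 12^-1.
Proof. by have := @coth_coef_evenS 1 isT; rewrite big_geq // -[1.*2]/2%N mulr1n => h; lra. Qed.

Lemma coth_coef4 : c 4 = - 720^-1.
Proof.
have := @coth_coef_evenS 2 isT; rewrite big_nat1 subn1 -[1.*2]/2%N -[2.*2]/4%N.
by rewrite coth_coef2 mulr0n => h; lra.
Qed.

(* Slightly above 1 / (4 pi^2), the decay rate of the coefficients c (2 k). *)
Definition rho : R := 37^-1.

(** Strong induction on the recursion. Its two extreme terms contain c 2 = 1/12, which exceeds 2 rho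
    and is kept exact; each of the k - 3 others is at most 4 rho^k. The start 1/720 <= 2 rho^2 is
    what makes 37 the largest possible integer value of 1 / rho. *)
Lemma coth_coef_even_le k : (1 < k)%N -> `|c k.*2| <= 2 * rho ^+ k.
Proof.
elim/ltn_ind: k => k IH k1.
have [k2|k2] := leqP k 2.
  have -> : k = 2%N by lia.
  have h : (0 : R) <= 720^-1 by rewrite invr_ge0 ler0n.
  rewrite -[2.*2]/4%N coth_coef4 normrN (ger0_norm h) /rho expr2.
  rewrite (_ : 720^-1 = 20^-1 * 36^-1); [lra | by rewrite -invfM -natrM].
have r0 : 0 < rho by rewrite /rho; lra.
have := coth_coef_evenS (ltnW k1).
have -> : (k == 1%N) = false by apply/eqP; lia.
rewrite mul0r sub0r => /(congr1 Num.norm); rewrite normrM normrN normr_nat => h.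
rewrite -(@ler_pM2l _ (k.*2.+1)%:R) ?ltr0n // h {h}.
apply: (le_trans (ler_norm_sum _ _ _)).
case: k k1 k2 IH => // -[//|k] _ k2 IH.
rewrite big_ltn // big_nat_recr //.
have -> : (k.+2 - 1)%N = k.+1 by lia.
have -> : (k.+2 - k.+1)%N = 1%N by lia.
have hk : `|c k.+1.*2| <= 2 * rho ^+ k.+1 by apply: IH; lia.
have h1 : `|c (1.*2)| = 12^-1 by rewrite -[1.*2]/2%N coth_coef2 ger0_norm ?invr_ge0.
rewrite !normrM. rewrite h1.
have hS : \sum_(2 <= i < k.+1) `|c i.*2 * c (k.+2 - i).*2| <= (k.+1 - 2)%:R * (4 * rho ^+ k.+2).
  rewrite big_nat; apply: (le_trans (y := \sum_(2 <= i < k.+1) 4 * rho ^+ k.+2)).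
    rewrite big_nat; apply: ler_sum => i /andP[i2 iK]; rewrite normrM.
    have -> : 4 * rho ^+ k.+2 = (2 * rho ^+ i) * (2 * rho ^+ (k.+2 - i)).
      rewrite mulrACA -exprD subnKC; last by lia.
      by congr (_ * _); lra.
    by apply: ler_pM => //; apply: IH; lia.
  by rewrite sumr_const_nat [leRHS]mulr_natl.
have h12 : (0 : R) <= 12^-1 by rewrite invr_ge0.
apply: le_trans (lerD (ler_wpM2l h12 hk) (lerD hS (ler_wpM2r h12 hk))) _.
rewrite natrB; last by lia.
have -> : (k.+2.*2.+1)%:R = 2 * k%:R + 5 :> R by rewrite -addnn; lra.
have -> : rho ^+ k.+2 = rho * rho ^+ k.+1 by rewrite exprS.
have : 0 < rho ^+ k.+1 by rewrite exprn_gt0.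
have : (0:R) <= k%:R by [].
rewrite /rho -[k.+1%:R]natr1; move: (k%:R) (_ ^+ k.+1) => x y x0 y0; nra.
Qed.

(** Exact terms of degree 0 and 2, then the geometric series of the bounds 2 (rho s^2)^k for k >= 2:
    it dominates 2 - (s/2) cot (s/2) as long as s^2 < 37. *)
Definition coth_maj (s : R) := 1 + s ^+ 2 / 12 + 2 * (rho * s ^+ 2) ^+ 2 / (1 - rho * s ^+ 2).

Lemma coth_maj_bound K s : rho * s ^+ 2 < 1 -> 
  \sum_(k < K) `|c k| * `|s| ^+ k <= coth_maj s.
Proof.
move=> hs; set q := rho * s ^+ 2 in hs.
have q0 : 0 <= q by rewrite mulr_ge0 ?sqr_ge0 // /rho; lra.
suff H n : \sum_(k < n.+2.*2) `|c k| * `|s| ^+ k <= 1 + s ^+ 2 / 12 + 2 * (q ^+ 2 - q ^+ n.+2) / (1 - q).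
  apply: (le_trans (y := \sum_(k < K.+2.*2) `|c k| * `|s| ^+ k)).
    have hK : (K <= K.+2.*2)%N by lia.
    rewrite (big_ord_widen _ (fun k => `|c k| * `|s| ^+ k) hK) [leRHS](bigID (fun i : 'I_ _ => (i < K)%N)) /=.
    by rewrite lerDl sumr_ge0 // => i _; rewrite mulr_ge0 ?exprn_ge0.
  apply: le_trans (H K) _; rewrite /coth_maj -/q lerD2l ler_pM2r ?invr_gt0 ?subr_gt0 //.
  by rewrite ler_pM2l // gerBl exprn_ge0.
elim: n => [|n IH].
  rewrite subrr mulr0 mul0r addr0 -[2.*2]/4%N !big_ord_recr big_ord0 /=.
  rewrite (coth_coef_odd (n := 1)) // (coth_coef_odd (n := 3)) // normr0 !mul0r coth_coef2.
  rewrite [c 0]coth_coef0 normr1 expr0 real_normK ?num_real // ger0_norm ?invr_ge0 //; lra.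
have E (F : nat -> R) : \sum_(k < n.+3.*2) F k =
    \sum_(k < n.+2.*2) F k + F n.+2.*2 + F n.+2.*2.+1 by rewrite doubleS 2!big_ord_recr.
have o1 : c n.+2.*2.+1 = 0 by apply: coth_coef_odd; rewrite oddS odd_double.
rewrite (E (fun k => `|c k| * `|s| ^+ k)) o1 normr0 mul0r addr0.
have h : `|c n.+2.*2| * `|s| ^+ n.+2.*2 <= 2 * q ^+ n.+2.
  rewrite -mul2n exprM real_normK ?num_real // /q [in leRHS]exprMn [leRHS]mulrA mul2n.
  by apply: ler_wpM2r; [rewrite exprn_ge0 ?sqr_ge0 | apply: coth_coef_even_le].
apply: le_trans (lerD IH h) _.
rewrite -addrA lerD2l [q ^+ n.+3]exprS.
have hq : 1 - q != 0 by rewrite subr_eq0 gt_eqF.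
rewrite le_eqVlt; apply/orP; left; apply/eqP; field.
by rewrite hq.
Qed.

End CothBounds.

(** * The lower bound *)

Section Barrier.
Variable R : realType.

(** Convexity of each monomial on the nonnegative axis: a chord is at most as steep as the tangent
    at its right end. *)
Lemma horner_sub_le_deriv (p : {poly R}) x y : (forall i, 0 <= p`_i) -> 0 <= x -> x <= y ->
  p.[y] - p.[x] <= (y - x) * p^`().[y].
Proof.
move=> p0 x0 xy.
have y0 : 0 <= y by apply: le_trans xy.
rewrite -(coefK p) poly_def raddf_sum /= !horner_sum -sumrB mulr_sumr.
apply: ler_sum => i _; rewrite derivZ derivXn !hornerZ hornerMn !hornerXn.
rewrite -mulrBr mulrCA ler_wpM2l // subrXX ler_wpM2l ?subr_ge0 //.
have -> : y ^+ i.-1 *+ i = \sum_(j < i) y ^+ i.-1 by rewrite sumr_const card_ord.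
apply: ler_sum => j _.
have h : (i.-1 - j + j = i.-1)%N by have := ltn_ord j; lia.
rewrite -{2}h exprD ler_wpM2l ?exprn_ge0 //.
by apply: lerXn2r.
Qed.

Lemma horner_ge0 (p : {poly R}) x : (forall i, 0 <= p`_i) -> 0 <= x -> 0 <= p.[x].
Proof.
move=> p0 x0; rewrite horner_coef; apply: sumr_ge0 => i _.
by rewrite mulr_ge0 ?exprn_ge0.
Qed.

Lemma rho_gt0 : 0 < rho R. Proof. by rewrite /rho invr_gt0. Qed.

Lemma rho_sqr_mono (s s' : R) : 0 <= s -> s <= s' -> rho R * s ^+ 2 <= rho R * s' ^+ 2.
Proof.
move=> s0 ss; rewrite ler_pM2l ?rho_gt0 //; apply: lerXn2r => //.
exact: le_trans ss.
Qed.

Lemma coth_maj_mono (s s' : R) : 0 <= s -> s <= s' -> rho R * s' ^+ 2 < 1 ->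
  coth_maj s <= coth_maj s'.
Proof.
move=> s0 ss h; have := rho_sqr_mono s0 ss.
have : 0 <= rho R * s ^+ 2 by rewrite mulr_ge0 ?sqr_ge0 // ltW ?rho_gt0.
have hs : s ^+ 2 <= s' ^+ 2 by rewrite lerXn2r // nnegrE (le_trans s0).
rewrite /coth_maj; move: h; move: (rho R * s' ^+ 2) (rho R * s ^+ 2) => q' q q1 q0 qq.
apply: lerD; first by lra.
have h1 : 0 < 1 - q' by lra.
have h2 : 0 < 1 - q by lra.
apply: ler_pM; rewrite ?invr_ge0 ?(ltW h2) //; first by rewrite mulr_ge0 ?sqr_ge0.
  by rewrite ler_pM2l // lerXn2r // nnegrE; lra.
by rewrite lef_pV2 ?posrE //; lra.
Qed.

Lemma coth_maj_ge1 (s : R) : rho R * s ^+ 2 < 1 -> 1 <= coth_maj s.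
Proof.
move=> h; rewrite /coth_maj -addrA lerDl addr_ge0 ?divr_ge0 ?sqr_ge0 //.
  by rewrite mulr_ge0 ?sqr_ge0.
by rewrite subr_ge0 ltW.
Qed.

Lemma coth_maj_le (x s d : R) : rho R * s ^+ 2 < 1 ->
  x * ((1 + s ^+ 2 / 12) * (1 - rho R * s ^+ 2) + 2 * (rho R * s ^+ 2) ^+ 2)
    <= d * (1 - rho R * s ^+ 2) ->
  x * coth_maj s <= d.
Proof.
rewrite /coth_maj; move: (rho R * s ^+ 2) => q q1 h.
have q0 : 0 < 1 - q by rewrite subr_gt0.
rewrite -(ler_pM2r q0); apply: le_trans h; rewrite le_eqVlt; apply/orP; left.
by apply/eqP; field; rewrite gt_eqF.
Qed.

Section Grid.
Variables (T sigma : nat -> R) (n : nat).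
Hypothesis T0 : T 0%N = 0.
Hypothesis Tmono : forall i, (i < n)%N -> T i <= T i.+1.
Hypothesis Tsigma : forall i, (i <= n)%N -> T i <= sigma i.
Hypothesis sigma_rho : forall i, (i <= n)%N -> rho R * sigma i ^+ 2 < 1.
Hypothesis step : forall i, (i < n)%N ->
  (T i.+1 - T i) * coth_maj (sigma i.+1) <= sigma i.+1 - sigma i.

(* Discretised comparison with the solution of U' = coth_maj U, U(0) = 0, which
   reaches sigma i at time T i or later; the iterates start at a <= U(a). *)
Lemma barrier (a : R) K j i t : 0 <= a -> (i <= n)%N -> 0 <= t -> a + t <= T i ->
  (wpoly a (symBCHl R K j)).[t] <= sigma i.
Proof.
move=> a0; elim: j i t => [|j IHj] i t.
  move=> iN t0 h; rewrite wpoly_symBCHl0 hornerC.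
  by apply: le_trans (Tsigma iN); lra.
elim: i t => [|i IHi] t iN t0 h.
  have -> : t = 0 by move: h; rewrite T0; lra.
  rewrite horner_coef0 coef_wpoly_symBCHl0.
  by apply: le_trans (Tsigma iN); lra.
set p := wpoly a (symBCHl R K j.+1); set p' := wpoly a (symBCHl R K j).
have pc k : 0 <= p`_k by apply: coef_wpoly_ge0.
have [hti|hti] := leP (a + t) (T i).
  apply: le_trans (IHi _ (ltnW iN) t0 hti) _.
  have := step iN; have := coth_maj_ge1 (sigma_rho iN); have := Tmono iN; nra.
(* The derivative of iterate j + 1 only involves iterate j, which stays below [sigma i.+1] by the
   outer induction. *)
have hG : p^`().[t] <= coth_maj (sigma i.+1).
  rewrite /p deriv_wpoly_symBCHl horner_sum.
  have p'0 : 0 <= p'.[t] by apply: horner_ge0 => // k; apply: coef_wpoly_ge0.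
  have p's : p'.[t] <= sigma i.+1 by apply: IHj.
  apply: le_trans (coth_maj_mono p'0 p's (sigma_rho iN)).
  have := @coth_maj_bound _ K p'.[t] (le_lt_trans (rho_sqr_mono p'0 p's) (sigma_rho iN)).
  rewrite ger0_norm //; apply: le_trans; apply: ler_sum => k _.
  by rewrite hornerZ horner_exp.
have G0 : 0 <= coth_maj (sigma i.+1) by apply: le_trans (coth_maj_ge1 (sigma_rho iN)).
have G1 := coth_maj_ge1 (sigma_rho iN).
(* If a > T i the chord starts at time 0 with value a. The excess a - T i is at most (a - T i) times
   [coth_maj], which is at least 1, so it fits in the budget of the step. *)
have [hai|hai] := leP a (T i).
  have h0 : 0 <= T i - a by lra.
  have := horner_sub_le_deriv pc h0 (ltW (_ : T i - a < t)).
  have hp := IHi (T i - a) (ltnW iN) h0.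
  move=> /(_ ltac:(lra)); rewrite -/p in hp.
  have := step iN; have := hp ltac:(lra).
  nra.
have := horner_sub_le_deriv pc (lexx 0) t0.
rewrite horner_coef0 coef_wpoly_symBCHl0 subr0 => hd.
have := step iN; have := Tsigma (ltnW iN); nra.
Qed.

End Grid.

End Barrier.

Section BCHBound.
Variable R : realType.

(* Lower Riemann sums, with step 1/2, of the integral of 1 / coth_maj from 0. *)
Definition grid_time : seq R :=
  [:: 0; 489/1000; 949/1000; 1367/1000; 1734/1000; 2048/1000; 2310/1000; 2522/1000;
      2689/1000; 2813/1000; 2897/1000; 2942/1000].

Lemma sym_bound (a t : R) K j : 0 <= a -> 0 <= t -> a + t <= 294/100 ->
  (wpoly a (symBCHl R K j)).[t] <= 11 / 2.
Proof.
move=> a0 t0 h.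
(* The value 11 / 2 is allotted the time 2.942, enough for 2.94; the remaining stretch up to 2 pi
   would add little. *)
apply: (@barrier R (fun i => grid_time`_i) (fun i => i%:R / 2) 11 _ _ _ _ _ a K j 11 t) => //.
- by do 11 (case=> [|]; [move=> _ /=; lra |]); move=> k.
- by do 12 (case=> [|]; [move=> _ /=; lra |]); move=> k.
- by do 12 (case=> [|]; [move=> _; rewrite /= /rho; lra |]); move=> k.
- by do 11 (case=> [|]; [move=> _; apply: coth_maj_le; rewrite /= /rho; lra |]); move=> k.
- by rewrite /=; lra.
Qed.

End BCHBound.

Section GammaBound.
Variable R : realType.
Implicit Types (P : word -> R) (s : seq (R * bracketing)).

Lemma lie_norm_ge0 P : (0 <= lie_norm P)%E.
Proof.
by apply: le_ereal_inf_tmp => _ [s _ <-]; rewrite lee_fin sumr_ge0.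
Qed.

Lemma lie_norm_le P s : lie_decomposition P s -> (lie_norm P <= (\sum_(p <- s) `|p.1|)%:E)%E.
Proof. by move=> H; apply: ereal_inf_lbound; exists s. Qed.

Lemma exp_sum_le (x : R) n : 0 <= x -> \sum_(k < n) x ^+ k / k`!%:R <= expR x.
Proof.
move=> x0; rewrite -(big_mkord predT (fun k => x ^+ k / k`!%:R)).
apply: (@nondecreasing_cvgn_le _ (series (exp_coeff x))); last exact: is_cvg_series_exp_coeff.
apply: nondecreasing_series => k _ _; exact: exp_coeff_ge0.
Qed.

Lemma BCHl_bound (a t : R) K N : 0 <= a -> 0 <= t -> a + t <= 294/100 ->
  (wpoly a (BCHl R K N)).[t] <= expR (t / 2) * (11 / 2).
Proof.
move=> a0 t0 h; rewrite /BCHl wpoly_sumscale horner_sum.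
rewrite (eq_bigr (fun k : 'I_K => (t / 2) ^+ k / k`!%:R * (wpoly a (symBCHl R K N)).[t])); last first.
  move=> k _; rewrite hornerZ wpoly_adl wpoly_gen hornerM horner_exp hornerZ hornerX.
  rewrite normrN !ger0_norm ?invr_ge0 //.
  by rewrite mulrA [t / 2]mulrC [_^-1 * _ ^+ k]mulrC.
rewrite -mulr_suml; apply: ler_pM => //.
- by apply: sumr_ge0 => k _; rewrite divr_ge0 ?exprn_ge0 ?divr_ge0.
- by apply: horner_ge0 => // i; apply: coef_wpoly_ge0.
- by apply: exp_sum_le; rewrite divr_ge0.
- exact: sym_bound.
Qed.

Definition bideg (m n : nat) s := [seq p <- s | (deg false p.2 == m) && (deg true p.2 == n)].

(** One list serves all components with m <= M and n <= N, so that their decompositions together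
    weigh no more than this list. *)
Lemma BCH_comp_decomposition K M N m n : (M + N < K)%N -> (m <= M)%N -> (n <= N)%N ->
  lie_decomposition (@BCH_comp R m n) (bideg m n (BCHl R K N)).
Proof.
move=> HK mM nN w; rewrite /BCH_comp /bideg big_filter.
case: (boolP (_ && _)) => [/andP[/eqP hm /eqP hn]|hw].
  rewrite BCHE (agree_BCHl R HK) ?hm ?hn // /evl ncs_sumE.
  rewrite [RHS]big_mkcond; apply: eq_bigr => p _; rewrite ncs_scaleE.
  case: ifP => // /negbT; rewrite negb_and => /orP[h|h].
    by rewrite (@lm_deg R _ false) ?mulr0 // hm eq_sym.
  by rewrite (@lm_deg R _ true) ?mulr0 // hn eq_sym.
rewrite big1 // => p /andP[/eqP h1 /eqP h2].
move: hw; rewrite negb_and -h1 -h2 => /orP[h|h]; rewrite -[lie_monomial _ _]/(lm R p.2).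
  by rewrite (@lm_deg R _ false) ?mulr0.
by rewrite (@lm_deg R _ true) ?mulr0.
Qed.

(** The sum is the supremum of its finite partial sums. For each of them one list of large enough
    order covers all the bidegrees, and its weight is bounded independently of the order. *)
Lemma GammaLie_bound (a t : R) : 0 <= a -> 0 <= t -> a + t <= 294/100 ->
  (GammaLie a t <= (expR (t / 2) * (11 / 2))%:E)%E.
Proof.
move=> a0 t0 h; apply: ge_ereal_sup => _ [F [finF _] <-].
rewrite fsbig_finite //=.
set r := (X in bigop _ X _).
pose M := (\max_(x <- r) (x.1 + x.2))%N.
have HM x : x \in r -> (x.1 <= M)%N /\ (x.2 <= M)%N.
  move=> xr; have : (x.1 + x.2 <= M)%N by rewrite /M (big_rem x) //= leq_maxl.
  by move=> ?; split; lia.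
pose K := (M + M).+1; pose s := BCHl R K M.
apply: (@le_trans _ _ (\sum_(x <- r) (\sum_(p <- bideg x.1 x.2 s) `|p.1| * (a ^+ x.1 * t ^+ x.2))%:E)%E).
  rewrite big_seq [leRHS]big_seq; apply: lee_sum => x xr; have [h1 h2] := HM _ xr.
  rewrite -mulr_suml [leRHS]EFinM; apply: lee_wpmul2r.
    by rewrite lee_fin mulr_ge0 ?exprn_ge0.
  by apply/lie_norm_le/(@BCH_comp_decomposition K M M).
rewrite sumEFin lee_fin; apply: le_trans (BCHl_bound K M a0 t0 h).
rewrite horner_wpoly -/s.
under eq_bigr do rewrite /bideg big_filter big_mkcond /=.
(* Each monomial has one bidegree, so it is counted at most once over r. *)
rewrite exchange_big /=; apply: ler_sum => p _.
have hp : 0 <= `|p.1| * a ^+ deg false p.2 * t ^+ deg true p.2 by rewrite !mulr_ge0 ?exprn_ge0.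
have [hr|hr] := boolP ((deg false p.2, deg true p.2) \in r); last first.
  rewrite big1_seq // => -[m n] /= mr; case: ifP => // /andP[/eqP h1 /eqP h2].
  by rewrite h1 h2 mr in hr.
rewrite (bigD1_seq (deg false p.2, deg true p.2)) ?fset_uniq //= !eqxx /=.
rewrite big1 ?addr0 ?mulrA // => -[m n] /= hmn; case: ifP => // /andP[/eqP h1 /eqP h2].
by rewrite h1 h2 eqxx in hmn.
Qed.

Lemma C2Lie_gt : ((293 / 100)%:E < C2Lie R)%E.
Proof.
apply: (@lt_le_trans _ _ ((294 / 100)%:E)); first by rewrite lte_fin; lra.
apply: ereal_sup_ubound; exists (294 / 100) => //; split; first lra.
apply: (@le_lt_trans _ _ (expR (294 / 100) * (11 / 2))%:E); last by rewrite ltry.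
apply: ge_ereal_sup => _ [[x1 x2] /= [x10 x20 hx] <-].
apply: le_trans (GammaLie_bound x10 x20 hx) _; rewrite lee_fin ler_wpM2r //.
by rewrite ler_expR; lra.
Qed.

End GammaBound.

(** * The minimum of Mi_fun *)

Section TrigTaylor.
Variable R : realType.

Definition cos_poly m : {poly R} := \sum_(k < m) ((-1) ^+ k / k.*2`!%:R) *: 'X^(k.*2).
Definition sin_poly m : {poly R} := \sum_(k < m) ((-1) ^+ k / k.*2.+1`!%:R) *: 'X^(k.*2.+1).

Let factS_div (c : R) n : c / n.+1`!%:R *+ n.+1 = c / n`!%:R.
Proof.
have hf : n`!%:R != 0 :> R by rewrite pnatr_eq0 -lt0n fact_gt0.
have hn : n.+1%:R != 0 :> R by rewrite pnatr_eq0.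
rewrite -mulr_natr factS natrM; move: (n.+1%:R) (n`!%:R) hf hn => x y hy hx.
by field; rewrite hy hx.
Qed.

Lemma deriv_sin_poly m : (sin_poly m)^`() = cos_poly m.
Proof.
rewrite /sin_poly raddf_sum; apply: eq_bigr => k _ /=.
by rewrite derivZ derivXn -scalerMnr scalerMnl factS_div.
Qed.

Lemma deriv_cos_poly m : (cos_poly m.+1)^`() = - sin_poly m.
Proof.
rewrite /cos_poly big_ord_recl derivD derivZ derivXn mulr0n scaler0 add0r.
rewrite raddf_sum -sumrN; apply: eq_bigr => k _; rewrite lift0 /=.
rewrite derivZ derivXn -scalerMnr scalerMnl -[k.+1.*2]/(k.*2.+2) factS_div.
by rewrite exprS mulN1r mulNr scaleNr.
Qed.

Lemma is_derive_horner (p : {poly R}) (x : R) : is_derive x 1 (horner p) p^`().[x].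
Proof.
by apply: DeriveDef; [exact: derivable_horner | rewrite -derive1E -derivE].
Qed.

Lemma is_derive_ge0_le (f df : R -> R) (x : R) : 0 <= x ->
  (forall y : R, is_derive y 1 f (df y)) -> (forall y, 0 <= y -> 0 <= df y) -> f 0 <= f x.
Proof.
move=> x0 Hd H0.
have Hc : {within `[0, x], continuous f}.
  apply: continuous_subspaceT => y.
  by apply: differentiable_continuous; apply/derivable1_diffP; case: (Hd y).
have [c hc E] := MVT_segment x0 (fun y _ => Hd y) Hc.
rewrite -subr_ge0 E subr0 mulr_ge0 // H0 //.
by move: hc; rewrite in_itv => /andP[].
Qed.

(** Repeated integration from 0, starting from cos <= 1: S passes from cos to sin, and the induction
    step from sin to the next polynomial of cos, with a change of sign. *)
Lemma trig_taylor m (x : R) : 0 <= x ->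
  0 <= (-1) ^+ m.+1 * (cos x - (cos_poly m.+1).[x]) /\
  0 <= (-1) ^+ m.+1 * (sin x - (sin_poly m.+1).[x]).
Proof.
have S n : (forall y : R, 0 <= y -> 0 <= (-1) ^+ n * (cos y - (cos_poly n).[y])) ->
    forall y : R, 0 <= y -> 0 <= (-1) ^+ n * (sin y - (sin_poly n).[y]).
  move=> H y y0.
  have Hd (z : R) : is_derive z 1 ((-1) ^+ n *: (@sin R - horner (sin_poly n)))
      ((-1) ^+ n * (cos z - (cos_poly n).[z])).
    apply: is_deriveZ; apply: is_deriveB.
    by rewrite -deriv_sin_poly; apply: is_derive_horner.
  have := is_derive_ge0_le y0 Hd H.
  rewrite /= !fctE /= sin0 horner_coef0 coef_sum big1 ?subrr ?scaler0 // => i _.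
  by rewrite coefZ coefXn mulr0.
elim: m x => [|m IH] x x0.
  have H0 (y : R) : 0 <= y -> 0 <= (-1) ^+ 1 * (cos y - (cos_poly 1).[y]).
    move=> _; rewrite /cos_poly big_ord1 /= double0 fact0 !expr0 divr1 scale1r hornerE.
    by rewrite expr1 mulN1r oppr_ge0 subr_le0 cos_le1.
  by split; [exact: H0 | exact: S H0 _ _].
have H0 (y : R) : 0 <= y -> 0 <= (-1) ^+ m.+2 * (cos y - (cos_poly m.+2).[y]).
  move=> y0.
  have Hd (z : R) : is_derive z 1 ((-1) ^+ m.+2 *: (@cos R - horner (cos_poly m.+2)))
      ((-1) ^+ m.+1 * (sin z - (sin_poly m.+1).[z])).
    have -> : (-1) ^+ m.+1 * (sin z - (sin_poly m.+1).[z]) =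
       (-1) ^+ m.+2 *: (- sin z - (cos_poly m.+2)^`().[z]).
      by rewrite deriv_cos_poly hornerN -[_ *: _]/(_ * _) [in RHS]exprS; ring.
    by apply: is_deriveZ; apply: is_deriveB; apply: is_derive_horner.
  have := is_derive_ge0_le y0 Hd (fun z z0 => (IH z z0).2).
  rewrite /= !fctE /= cos0 horner_coef0 coef_sum big_ord_recl big1; last first.
    by move=> i _; rewrite coefZ coefXn mulr0.
  by rewrite coefZ coefXn /= double0 fact0 invr1 expr0 !mulr1 addr0 subrr scaler0.
by split; [exact: H0 | exact: S H0 _ _].
Qed.

End TrigTaylor.

Section MinimumOfMi.
Variable R : realType.

Definition cos_sum m (u : R) : R := \sum_(k < m) (-1) ^+ k * (k.*2`!%:R)^-1 * u ^+ k.

Lemma horner_cos_poly m (x : R) : (cos_poly R m).[x] = cos_sum m (x ^+ 2).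
Proof.
rewrite /cos_poly horner_sum; apply: eq_bigr => k _.
by rewrite hornerZ hornerXn -exprM mul2n.
Qed.

Lemma cos_ge_sum m (x : R) : 0 <= x -> ~~ odd m -> (0 < m)%N -> cos_sum m (x ^+ 2) <= cos x.
Proof.
case: m => // m x0 om _; have := (trig_taylor m x0).1.
by rewrite -signr_odd (negbTE om) expr0 mul1r subr_ge0 horner_cos_poly.
Qed.

Lemma cos_le_sum m (x : R) : 0 <= x -> odd m -> cos x <= cos_sum m (x ^+ 2).
Proof.
case: m => // m x0 om; have := (trig_taylor m x0).1.
by rewrite -signr_odd om expr1 mulN1r oppr_ge0 subr_le0 horner_cos_poly.
Qed.

Let a k : R := (k.*2`!%:R)^-1.

Lemma inv_double_factS k : ((k.*2.+1) * (k.*2.+2))%:R * a k.+1 = a k.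
Proof.
rewrite /a doubleS !factS !natrM.
have hf : k.*2`!%:R != 0 :> R by rewrite pnatr_eq0 -lt0n fact_gt0.
have h1 : k.*2.+1%:R != 0 :> R by rewrite pnatr_eq0.
have h2 : k.*2.+2%:R != 0 :> R by rewrite pnatr_eq0.
move: (k.*2`!%:R) (k.*2.+1%:R) (k.*2.+2%:R) hf h1 h2 => y z t hy hz ht.
by field; rewrite hy hz ht.
Qed.

(* Recursive linear relations between the inverse factorials keep all literals small. *)
Lemma cos_sum8 (u : R) : exists a1 a2 a3 a4 a5 a6 a7 a8 : R,
  [/\ [/\ 2 * a1 = 1, 12 * a2 = a1, 30 * a3 = a2 & 56 * a4 = a3],
      [/\ 90 * a5 = a4, 132 * a6 = a5, 182 * a7 = a6 & 240 * a8 = a7],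
      cos_sum 8 u = 1 - a1 * u + a2 * u ^+ 2 - a3 * u ^+ 3 + a4 * u ^+ 4 - a5 * u ^+ 5
        + a6 * u ^+ 6 - a7 * u ^+ 7
    & cos_sum 9 u = cos_sum 8 u + a8 * u ^+ 8].
Proof.
have a0 : a 0 = 1 by rewrite /a double0 fact0 invr1.
have G (b : nat -> R) : b 0%N = 1 -> \sum_(k < 8) (-1) ^+ k * b k * u ^+ k =
    1 - b 1 * u + b 2 * u ^+ 2 - b 3 * u ^+ 3 + b 4 * u ^+ 4 - b 5 * u ^+ 5 + b 6 * u ^+ 6 - b 7 * u ^+ 7.
  by move=> b0; rewrite !big_ord_recr big_ord0 /= b0; ring.
exists (a 1), (a 2), (a 3), (a 4), (a 5), (a 6), (a 7), (a 8); split.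
- split; [by have := inv_double_factS 0; rewrite a0 | exact: (inv_double_factS 1)
    | exact: (inv_double_factS 2) | exact: (inv_double_factS 3)].
- split; [exact: (inv_double_factS 4) | exact: (inv_double_factS 5)
    | exact: (inv_double_factS 6) | exact: (inv_double_factS 7)].
- exact: (G a a0).
- rewrite /cos_sum big_ord_recr; congr (_ + _).
  by rewrite -signr_odd expr0 mul1r.
Qed.

(** L and U are the decimals 5.402857 and 5.4028571, split so that every literal stays small. *)
Let L : R := 5 + 402 / 10 ^+ 3 + 857 / 10 ^+ 6.
Let U : R := 5 + 402 / 10 ^+ 3 + 857 / 10 ^+ 6 + 1 / 10 ^+ 7.

Lemma pow_mul_le (u v : R) i j : 0 <= u -> u <= 8 -> 0 <= v -> v <= 4 ->
  u ^+ i * v ^+ j <= 8 ^+ i * 4 ^+ j.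
Proof.
by move=> u0 u8 v0 v4; apply: ler_pM; rewrite ?exprn_ge0 //; apply: lerXn2r; rewrite ?nnegrE.
Qed.

(* The tangent at v lies below the polynomial, whose quadratic coefficient dominates. *)
Lemma poly7_ge_tangent (c0 c1 c2 c3 c4 c5 c6 c7 u v : R) :
  0 <= u -> u <= 73 / 10 -> 0 <= v -> v <= 39 / 10 ->
  126 / 10 ^+ 3 <= c2 -> - (5 / 10 ^+ 3) <= c3 -> 0 <= c4 -> - (2 / 10 ^+ 6) <= c5 ->
  0 <= c6 -> - (1 / 10 ^+ 8) <= c7 ->
  c0 + c1 * v + c2 * v ^+ 2 + c3 * v ^+ 3 + c4 * v ^+ 4 + c5 * v ^+ 5 + c6 * v ^+ 6 + c7 * v ^+ 7
  + (c1 + 2 * c2 * v + 3 * c3 * v ^+ 2 + 4 * c4 * v ^+ 3 + 5 * c5 * v ^+ 4 + 6 * c6 * v ^+ 5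
     + 7 * c7 * v ^+ 6) * (u - v) <=
  c0 + c1 * u + c2 * u ^+ 2 + c3 * u ^+ 3 + c4 * u ^+ 4 + c5 * u ^+ 5 + c6 * u ^+ 6 + c7 * u ^+ 7.
Proof.
move=> u0 u7 v0 v4 h2 h3 h4 h5 h6 h7.
(* Each Pk is the quotient of u^k - v^k - k v^(k-1) (u - v) by (u - v)^2. *)
pose P5 := u ^+ 3 + 2 * (u ^+ 2 * v) + 3 * (u * v ^+ 2) + 4 * v ^+ 3.
pose P7 := u ^+ 5 + 2 * (u ^+ 4 * v) + 3 * (u ^+ 3 * v ^+ 2) + 4 * (u ^+ 2 * v ^+ 3)
  + 5 * (u * v ^+ 4) + 6 * v ^+ 5.
pose P6 := u ^+ 4 + 2 * (u ^+ 3 * v) + 3 * (u ^+ 2 * v ^+ 2) + 4 * (u * v ^+ 3) + 5 * v ^+ 4.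
pose P4 := u ^+ 2 + 2 * (u * v) + 3 * v ^+ 2.
rewrite -subr_ge0.
rewrite [X in 0 <= X](_ : _ = (u - v) ^+ 2 *
  (c2 + c3 * (u + 2 * v) + c4 * P4 + c5 * P5 + c6 * P6 + c7 * P7)); last first.
  by rewrite /P4 /P5 /P6 /P7; ring.
rewrite mulr_ge0 ?sqr_ge0 //.
have uv i j : 0 <= u ^+ i * v ^+ j by rewrite mulr_ge0 ?exprn_ge0.
have P40 : 0 <= c4 * P4 by rewrite mulr_ge0 // /P4; have := (uv 2 0, uv 1 1, uv 0 2); rewrite !expr0 !expr1 => -[[? ?] ?]; lra.
have P60 : 0 <= c6 * P6.
  rewrite mulr_ge0 // /P6; have := (uv 4 0, uv 3 1, uv 2 2, uv 1 3, uv 0 4).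
  by rewrite !expr0 !expr1 => -[[[[? ?] ?] ?] ?]; lra.
have b i j := @pow_mul_le u v i j u0 ltac:(lra) v0 ltac:(lra).
(* The upper bounds for P5 and P7 are their values at u = 8, v = 4, the second one rounded up. *)
have P50 : 0 <= P5 <= 1664.
  rewrite /P5; have := (uv 3 0, uv 2 1, uv 1 2, uv 0 3); have := (b 3 0, b 2 1, b 1 2, b 0 3).
  by rewrite !expr0 !expr1 => -[[[? ?] ?] ?] [[[? ?] ?] ?]; lra.
have P70 : 0 <= P7 <= 123 * 10 ^+ 3.
  rewrite /P7; have := (uv 5 0, uv 4 1, uv 3 2, uv 2 3, uv 1 4, uv 0 5).
  have := (b 5 0, b 4 1, b 3 2, b 2 3, b 1 4, b 0 5).
  by rewrite !expr0 !expr1 => -[[[[[? ?] ?] ?] ?] ?] [[[[[? ?] ?] ?] ?] ?]; lra.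
case/andP: P50 => P50 P51; case/andP: P70 => P70 P71.
have h3' : - (5 / 10 ^+ 3) * (u + 2 * v) <= c3 * (u + 2 * v) by rewrite ler_wpM2r //; lra.
have h5' : - (2 / 10 ^+ 6) * P5 <= c5 * P5 by rewrite ler_wpM2r.
have h7' : - (1 / 10 ^+ 8) * P7 <= c7 * P7 by rewrite ler_wpM2r.
lra.
Qed.

(** The constant terms cancel and u factors out of the difference. The other factor lies above its
    tangent at v, which has height at least 7/10^8 and slope at most 1/10^9 in absolute value. The
    range ends just above L^2 / 4, where [Mi_fun_ge_large] takes over. *)
Lemma Mi_poly_lower (u : R) : 0 <= u -> u <= 73 / 10 ->
  L ^+ 2 - 12 * u <= cos_sum 8 u * (L ^+ 2 + 4 * u).
Proof.
move=> u0 u7.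
have [a1 [a2 [a3 [a4 [a5 [a6 [a7 [a8 [[e1 e2 e3 e4] [e5 e6 e7 _] -> _]]]]]]]]] := cos_sum8 u.
(* v approximates the double root at the minimizer. *)
pose v : R := 3 + 899 / 10 ^+ 3 + 643 / 10 ^+ 6 + 55 / 10 ^+ 8.
pose c0 := 16 - L ^+ 2 * a1. pose c1 := L ^+ 2 * a2 - 4 * a1. pose c2 := 4 * a2 - L ^+ 2 * a3.
pose c3 := L ^+ 2 * a4 - 4 * a3. pose c4 := 4 * a4 - L ^+ 2 * a5.
pose c5 := L ^+ 2 * a6 - 4 * a5. pose c6 := 4 * a6 - L ^+ 2 * a7. pose c7 := - 4 * a7.
pose A := c0 + c1 * v + c2 * v ^+ 2 + c3 * v ^+ 3 + c4 * v ^+ 4 + c5 * v ^+ 5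
    + c6 * v ^+ 6 + c7 * v ^+ 7.
pose B := c1 + 2 * c2 * v + 3 * c3 * v ^+ 2 + 4 * c4 * v ^+ 3
    + 5 * c5 * v ^+ 4 + 6 * c6 * v ^+ 5 + 7 * c7 * v ^+ 6.
have hA : 7 / 10 ^+ 8 <= A.
  by rewrite /A /c0 /c1 /c2 /c3 /c4 /c5 /c6 /c7 /v /L; lra.
have B1 : - (1 / 10 ^+ 9) <= B by rewrite /B /c1 /c2 /c3 /c4 /c5 /c6 /c7 /v /L; lra.
have B2 : B <= 1 / 10 ^+ 9 by rewrite /B /c1 /c2 /c3 /c4 /c5 /c6 /c7 /v /L; lra.
have h2 : 126 / 10 ^+ 3 <= c2 by rewrite /c2 /L; lra.
have h3 : - (5 / 10 ^+ 3) <= c3 by rewrite /c3 /L; lra.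
have h4 : 0 <= c4 by rewrite /c4 /L; lra.
have h5 : - (2 / 10 ^+ 6) <= c5 by rewrite /c5 /L; lra.
have h6 : 0 <= c6 by rewrite /c6 /L; lra.
have h7 : - (1 / 10 ^+ 8) <= c7 by rewrite /c7 /L; lra.
have v0 : 0 <= v <= 39 / 10 by rewrite /v; lra.
case/andP: v0 => v0 v4.
have h : A + B * (u - v) <= c0 + c1 * u + c2 * u ^+ 2 + c3 * u ^+ 3 + c4 * u ^+ 4
    + c5 * u ^+ 5 + c6 * u ^+ 6 + c7 * u ^+ 7.
  exact: poly7_ge_tangent.
have hBu : - (1 / 10 ^+ 8) <= B * (u - v) by nra.
have {h}h : 0 <= c0 + c1 * u + c2 * u ^+ 2 + c3 * u ^+ 3 + c4 * u ^+ 4 + c5 * u ^+ 5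
    + c6 * u ^+ 6 + c7 * u ^+ 7.
  by apply: le_trans h; move: hA hBu {B1 B2}; move: (B * _) A => x y; lra.
rewrite -subr_ge0 [X in 0 <= X](_ : _ = u * (c0 + c1 * u + c2 * u ^+ 2 + c3 * u ^+ 3
    + c4 * u ^+ 4 + c5 * u ^+ 5 + c6 * u ^+ 6 + c7 * u ^+ 7)).
  by rewrite mulr_ge0.
by rewrite /c0 /c1 /c2 /c3 /c4 /c5 /c6 /c7; ring.
Qed.

(** 79 / 80 approximates acos of the minimizer; nine Taylor terms bound cos from above. *)
Lemma Mi_poly_upper (u : R) : u = (79 / 40) ^+ 2 ->
  cos_sum 9 u * (U ^+ 2 + 4 * u) < U ^+ 2 - 12 * u.
Proof.
move=> hu; have [a1 [a2 [a3 [a4 [a5 [a6 [a7 [a8 [[e1 e2 e3 e4] [e5 e6 e7 e8] E8 E9]]]]]]]]] := cos_sum8 u.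
rewrite E9 E8 hu /U {E8 E9 hu}; lra.
Qed.

End MinimumOfMi.

Section Minimum.
Variable R : realType.

Let sq (w : R) := (w *+ 2) ^+ 2.

Lemma Mi_fun_cos (w : R) : 0 < w -> w < pi / 2 ->
  Mi_fun (cos w) = w / sin w * (2 * Num.sqrt (1 + cos w ^+ 2)).
Proof.
move=> w0 wpi; have hpi := @pi_gt0 R.
rewrite /Mi_fun cosK; last by rewrite in_itv /=; apply/andP; split; lra.
have sw : 0 < sin w by apply: sin_gt0_pi; apply/andP; split; lra.
by rewrite -sin2cos2 sqrtr_sqr (gtr0_norm sw).
Qed.

(** For d = cos w, the half-angle formulas 1 - d^2 = (1 - cos 2w) / 2 and 1 + d^2 = (3 + cos 2w) / 2
    remove both square roots; comparisons with [Mi_fun] become linear in cos 2w. *)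
Lemma Mi_fun_sqr (w : R) : 0 < w -> w < pi / 2 ->
  0 < Mi_fun (cos w) /\ 
  (2 * Mi_fun (cos w)) ^+ 2 * (1 - cos (w *+ 2)) = 4 * sq w * (3 + cos (w *+ 2)).
Proof.
move=> w0 wpi; have hpi := @pi_gt0 R.
have sw : 0 < sin w by apply: sin_gt0_pi; apply/andP; split; lra.
have c0 : 0 < 1 + cos w ^+ 2 by rewrite ltr_pwDl ?sqr_ge0.
rewrite Mi_fun_cos //; split; first by rewrite !mulr_gt0 ?invr_gt0 ?sqrtr_gt0.
have hs := sqr_sqrtr (ltW c0).
rewrite cos_mulr2n /sq.
have h2 : sin w ^+ 2 = 1 - cos w ^+ 2 := sin2cos2 w.
have sw0 : sin w != 0 by rewrite gt_eqF.
move: (Num.sqrt _) hs => r hs.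
rewrite (_ : 1 - _ = 2 * sin w ^+ 2); last by rewrite h2; ring.
rewrite (_ : 3 + _ = 2 * r ^+ 2); last by rewrite hs; ring.
by field.
Qed.

Lemma cos_mulr2n_lt1 (w : R) : 0 < w -> w < pi / 2 -> cos (w *+ 2) < 1.
Proof.
move=> w0 wpi; have hpi := @pi_gt0 R.
have sw : 0 < sin w by apply: sin_gt0_pi; apply/andP; split; lra.
have := sin2cos2 w; have : 0 < sin w ^+ 2 by rewrite exprn_gt0.
by rewrite cos_mulr2n; move: (sin w ^+ 2) (cos w ^+ 2) => x y; lra.
Qed.

Lemma Mi_fun_ge (B w : R) : 0 < w -> w < pi / 2 -> 0 <= B ->
  B ^+ 2 - 12 * sq w <= cos (w *+ 2) * (B ^+ 2 + 4 * sq w) -> B <= 2 * Mi_fun (cos w).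
Proof.
move=> w0 wpi B0 h; have [M0 E] := Mi_fun_sqr w0 wpi; have c1 := cos_mulr2n_lt1 w0 wpi.
rewrite -(@ler_pXn2r _ 2) ?nnegrE //; last by rewrite mulr_ge0 // ltW.
have c1' : 0 < 1 - cos (w *+ 2) by lra.
rewrite -(ler_pM2r c1') E.
move: h; move: (cos _) (sq w) => x y; lra.
Qed.

Lemma Mi_fun_lt (B w : R) : 0 < w -> w < pi / 2 -> 0 <= B ->
  cos (w *+ 2) * (B ^+ 2 + 4 * sq w) < B ^+ 2 - 12 * sq w -> 2 * Mi_fun (cos w) < B.
Proof.
move=> w0 wpi B0 h; have [M0 E] := Mi_fun_sqr w0 wpi; have c1 := cos_mulr2n_lt1 w0 wpi.
rewrite -(@ltr_pXn2r _ 2) ?nnegrE //; last by rewrite mulr_ge0 // ltW.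
have c1' : 0 < 1 - cos (w *+ 2) by lra.
rewrite -(ltr_pM2r c1') E.
move: h; move: (cos _) (sq w) => x y; lra.
Qed.

Lemma acos_itv (d : R) : 0 < d < 1 -> [/\ 0 < acos d, acos d < pi / 2 & cos (acos d) = d].
Proof.
case/andP=> d0 d1; have hpi := @pi_gt0 R.
have hd : -1 <= d <= 1 by apply/andP; split; lra.
have hK : cos (acos d) = d by apply: acosK; rewrite in_itv.
split=> //; first by apply: acos_gt0; apply/andP; split; lra.
have i1 : acos d \in `[0, pi]%R by rewrite in_itv /= acos_ge0 // acos_lepi.
have i2 : (pi / 2 : R) \in `[0, pi]%R by rewrite in_itv /=; apply/andP; split; lra.
by rewrite -(ltr_cos i1 i2) hK cos_pihalf.
Qed.

Let L : R := 5 + 402 / 10 ^+ 3 + 857 / 10 ^+ 6.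
Let U : R := 5 + 402 / 10 ^+ 3 + 857 / 10 ^+ 6 + 1 / 10 ^+ 7.

(** In this range the trivial bound cos >= -1 is enough. *)
Lemma Mi_fun_ge_large (B w : R) : 0 < w -> w < pi / 2 -> 0 <= B ->
  B ^+ 2 <= 4 * sq w -> B <= 2 * Mi_fun (cos w).
Proof.
move=> w0 wpi B0 h; apply: Mi_fun_ge => //.
have := cos_geN1 (w *+ 2); have : 0 <= sq w by apply: sqr_ge0.
have : 0 <= B ^+ 2 by apply: sqr_ge0.
move: h; move: (cos _) (sq w) (B ^+ 2) => x y z; nra.
Qed.

Lemma Mi_fun_lower (d : R) : 0 < d < 1 -> L <= 2 * Mi_fun d.
Proof.
move=> /acos_itv [w0 wpi <-]; set w := acos d in w0 wpi *.
have L0 : 0 <= L by rewrite /L; lra.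
have [h|h] := leP (sq w) (73 / 10); last first.
  by apply: Mi_fun_ge_large => //; move: h; rewrite /L; lra.
apply: Mi_fun_ge => //; apply: le_trans (Mi_poly_lower (sqr_ge0 _) h) _.
apply: ler_wpM2r; first by rewrite addr_ge0 ?sqr_ge0 // mulr_ge0 ?sqr_ge0.
by apply: cos_ge_sum => //; rewrite mulrn_wge0 // ltW.
Qed.

Lemma cos_sum4 (u : R) : cos_sum 4 u = 1 - u / 2 + u ^+ 2 / 24 - u ^+ 3 / 720.
Proof.
rewrite /cos_sum !big_ord_recr big_ord0 /=.
rewrite (_ : 0.*2`! = 1%N) // (_ : 1.*2`! = 2%N) // (_ : 2.*2`! = 24%N) //.
by rewrite (_ : 3.*2`! = 720%N) // invr1; ring.
Qed.

Lemma cos_sum2 (u : R) : cos_sum 2 u = 1 - u / 2.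
Proof.
rewrite /cos_sum !big_ord_recr big_ord0 /=.
by rewrite (_ : 0.*2`! = 1%N) // (_ : 1.*2`! = 2%N) // invr1; ring.
Qed.

Lemma pihalf_gt : 271 / 200 < pi / 2 :> R.
Proof.
have h x : 0 <= x -> x <= 271 / 200 -> 0 < cos x :> R.
  move=> x0 x1; have := @cos_ge_sum R 4 x x0 isT isT; apply: lt_le_trans.
  have u0 : 0 <= x ^+ 2 by apply: sqr_ge0.
  have u1 : x ^+ 2 <= 184 / 100 by nra.
  rewrite cos_sum4; move: (x ^+ 2) u0 u1 => u u0 u1.
  have : 0 <= u ^+ 2 * (184 / 100 - u) by apply: mulr_ge0; [apply: sqr_ge0 | rewrite subr_ge0].
  have : 0 <= u ^+ 2 by apply: sqr_ge0.
  lra.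
rewrite ltNge; apply/negP => hp; have /andP[p0 _] := @pihalf_02 R.
by have := h _ (ltW p0) hp; rewrite cos_pihalf ltxx.
Qed.

Lemma Mi_fun_continuous (d : R) : 0 < d < 1 -> {for d, continuous (@Mi_fun R)}.
Proof.
move=> /andP[d0 d1].
have c1 : {for d, continuous (@acos R)} by apply: continuous_acos; apply/andP; split; lra.
have hs (f : R -> R) : {for d, continuous f} -> {for d, continuous (fun x => Num.sqrt (f x))}.
  by move=> hf; apply: continuous_comp => //; exact: sqrt_continuous.
have hsq : {for d, continuous (fun x : R => x ^+ 2)} by exact: exprn_continuous.
have h1 : Num.sqrt (1 - d ^+ 2) != 0.
  by rewrite gt_eqF // sqrtr_gt0 subr_gt0 exprn_ilt1 // ltW.
rewrite /Mi_fun; apply: cvgM.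
  apply: cvgM => //; apply: cvgV => //; apply: hs.
  by apply: cvgB => //; apply: cvg_cst.
apply: cvgM; first exact: cvg_cst.
by apply: hs; apply: cvgD => //; apply: cvg_cst.
Qed.

Lemma v_Mi_facts : 
  (exists d : R, 0 < d < 1 /\ Mi_fun d = v_Mi R) /\ L <= 2 * v_Mi R < U.
Proof.
have hpi := pihalf_gt.
have U0 : 0 <= U by rewrite /U; lra.
pose w0 : R := 79 / 80.
have w0U : 2 * Mi_fun (cos w0) < U.
  have e : sq w0 = (79 / 40) ^+ 2 by rewrite /sq /w0; field.
  apply: Mi_fun_lt => //; rewrite /w0; [lra | lra | ].
  apply: le_lt_trans (Mi_poly_upper e).
  apply: ler_wpM2r; first by rewrite addr_ge0 ?sqr_ge0 // mulr_ge0 ?sqr_ge0.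
  by apply: cos_le_sum => //; rewrite mulrn_wge0 //; lra.
(* Outside [d1, d2] the double of [Mi_fun] is at least 5.41 > U: for acos d > 271/200 because 4 acos
   d > 5.41, for acos d < 4/10 because cos x >= 1 - x^2/2. So the minimum on this compact interval
   is global. *)
pose d1 : R := cos (271 / 200). pose d2 : R := cos (4 / 10).
have itv (w : R) : 0 <= w -> w <= 271 / 200 -> w \in `[0, pi]%R.
  by move=> h1 h2; rewrite in_itv /=; apply/andP; split; lra.
have d10 : 0 < d1 by apply: cos_gt0_pihalf; apply/andP; split; lra.
have d21 : d2 < 1 by rewrite -cos0 /d2 ltr_cos; [lra | apply: itv; lra | apply: itv; lra].
have d1w : d1 < cos w0 by rewrite /d1 ltr_cos; [rewrite /w0; lra | apply: itv; rewrite /w0; lra ..].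
have d2w : cos w0 < d2 by rewrite /d2 ltr_cos; [rewrite /w0; lra | apply: itv; rewrite /w0; lra ..].
have [c hc hmin] : exists2 c, c \in `[d1, d2]%R & forall t, t \in `[d1, d2]%R -> Mi_fun c <= Mi_fun t.
  apply: EVT_min; first lra.
  apply: continuous_in_subspaceT => x; rewrite in_setE /= in_itv /= => /andP[h1 h2].
  by apply: Mi_fun_continuous; apply/andP; split; lra.
have c01 : 0 < c < 1 by move: hc; rewrite in_itv /= => /andP[? ?]; apply/andP; split; lra.
have cU : 2 * Mi_fun c < U.
  have : Mi_fun c <= Mi_fun (cos w0) by apply: hmin; rewrite in_itv /= !ltW.
  by move: w0U; move: (Mi_fun _) (Mi_fun _) U => x y z; lra.
have cmin d : 0 < d < 1 -> Mi_fun c <= Mi_fun d.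
  move=> d01; have [hd|hd] := boolP (d \in `[d1, d2]%R); first exact: hmin.
  have [v0 vpi vK] := acos_itv d01.
  suff : 541 / 100 <= 2 * Mi_fun d.
    by move: cU; rewrite /U; move: (Mi_fun c) (Mi_fun d) => x y; lra.
  have vi : acos d \in `[0, pi]%R by rewrite in_itv /=; apply/andP; split; lra.
  have B0 : 0 <= 541 / 100 :> R by lra.
  have i1 : (271 / 200 : R) \in `[0, pi]%R by apply: itv; lra.
  have i2 : (4 / 10 : R) \in `[0, pi]%R by apply: itv; lra.
  move: hd; rewrite in_itv /= negb_and -!ltNge -vK /d1 /d2 (ltr_cos i1 vi) (ltr_cos vi i2).
  move=> /orP[h|h].
    apply: Mi_fun_ge_large => //; rewrite /sq; move: (acos d) h => v h; nra.
  apply: Mi_fun_ge => //.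
  have hs : sq (acos d) <= 64 / 100 by rewrite /sq; move: (acos d) h v0 => v; nra.
  have v20 : 0 <= acos d *+ 2 by rewrite mulrn_wge0 // ltW.
  have := @cos_ge_sum R 2 _ v20 isT isT; rewrite -/(sq _) cos_sum2.
  have : 0 <= sq (acos d) by apply: sqr_ge0.
  move: hs; move: (sq _) (cos _) => x y; nra.
have vE : v_Mi R = Mi_fun c.
  apply/eqP; rewrite eq_le; apply/andP; split.
    apply: inf_lbound; last by exists c => //=; rewrite in_itv /=.
    by exists (Mi_fun c) => y [d hd <-]; apply: cmin; move: hd; rewrite /= in_itv.
  apply: lb_le_inf; first by exists (Mi_fun c), c => //=; rewrite in_itv.
  by move=> y [d hd <-]; apply: cmin; move: hd; rewrite /= in_itv.
split; first by exists c.
by rewrite vE cU andbT; exact: Mi_fun_lower.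
Qed.

End Minimum.

(** * Evaluation at 2 x 2 matrices *)

Section TwoByTwo.

Lemma ord2P (i : 'I_2) : i = 0 \/ i = 1.
Proof. by case: i => -[|[|//]] ?; [left|right]; apply/val_inj. Qed.

Lemma mulmx2E (S : nzRingType) (M N : 'M[S]_2) i j :
  (M * N) i j = M i 0 * N 0 j + M i 1 * N 1 j.
Proof.
have e : lift ord0 ord0 = 1 :> 'I_2 by apply/val_inj.
by rewrite mxE !big_ord_recl big_ord0 addr0 e.
Qed.

Lemma mxtrace2 (S : nzRingType) (M : 'M[S]_2) : \tr M = M 0 0 + M 1 1.
Proof.
have e : lift ord0 ord0 = 1 :> 'I_2 by apply/val_inj.
by rewrite /mxtrace !big_ord_recl big_ord0 addr0 e.
Qed.

End TwoByTwo.

Section Evaluation.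
Variables (R : realType) (A B : 'M[R]_2).
Implicit Types (f g : ncs R) (M : 'M[R]_2).

Let gen (b : bool) := if b then B else A.

(** The value at (A, B) of the homogeneous component of degree n, a finite sum over words; no
    convergence is involved. *)
Fixpoint eval_deg n f : 'M[R]_2 :=
  if n is m.+1 then A * eval_deg m (fun w => f (false :: w)) + B * eval_deg m (fun w => f (true :: w))
  else (f [::])%:M.

Lemma eval_deg_ext n f g : (forall w, size w = n -> f w = g w) -> eval_deg n f = eval_deg n g.
Proof.
elim: n f g => [|n IH] f g H /=; first by rewrite H.
by congr (_ * _ + _ * _); apply: IH => w Hw; apply: H; rewrite /= Hw.
Qed.

Lemma eval_degD n f g : eval_deg n (f + g) = eval_deg n f + eval_deg n g.
Proof.
elim: n f g => [|n IH] f g /=; first by rewrite ncs_addE raddfD.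
have E b : (fun w => (f + g) (b :: w)) = (fun w => f (b :: w)) + (fun w => g (b :: w)) :> ncs R by [].
by rewrite !E !IH !mulrDr addrACA.
Qed.

Lemma eval_degZ n c f : eval_deg n (c *: f) = c *: eval_deg n f.
Proof.
elim: n f => [|n IH] f /=; first by rewrite ncs_scaleE scale_scalar_mx.
have E b : (fun w => (c *: f) (b :: w)) = c *: ((fun w => f (b :: w)) : ncs R) by [].
by rewrite !E !IH -!scalerAr scalerDr.
Qed.

Lemma eval_deg0 n : eval_deg n 0 = 0.
Proof. by rewrite -(scale0r 0) eval_degZ scale0r. Qed.

Lemma eval_degB n f g : eval_deg n (f - g) = eval_deg n f - eval_deg n g.
Proof. by rewrite eval_degD -scaleN1r eval_degZ scaleN1r. Qed.

Lemma eval_deg_sum n I (r : seq I) (P : pred I) (F : I -> ncs R) :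
  eval_deg n (\sum_(i <- r | P i) F i) = \sum_(i <- r | P i) eval_deg n (F i).
Proof.
by elim/big_rec2: _ => [|i x y _ <-]; rewrite ?eval_deg0 ?eval_degD.
Qed.

Lemma eval_degM n f g :
  eval_deg n (f * g) = \sum_(i < n.+1) eval_deg i f * eval_deg (n - i) g.
Proof.
elim: n f => [|n IH] f.
  by rewrite big_ord1 /= -!ncs_mulE nc_mul_nil rmorphM.
have E b : (fun w => (f * g) (b :: w)) =
    f [::] *: ((fun w => g (b :: w)) : ncs R) + ((fun w => f (b :: w)) : ncs R) * g :> ncs R.
  by apply/funext => w; rewrite -!ncs_mulE nc_mul_cons.
rewrite [LHS]/= !E !eval_degD !eval_degZ !IH !mulrDr addrACA [RHS]big_ord_recl; congr (_ + _).
  rewrite subn0 [eval_deg ord0 f]/= [in RHS]/= -[(f [::])%:M * _]/(_ *m _) mul_scalar_mx.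
  by rewrite scalerDr -!scalerAr.
rewrite !mulr_sumr -big_split; apply: eq_bigr => i _; rewrite lift0 subSS /=.
by rewrite !mulrA -mulrDl.
Qed.

Lemma eval_deg1 n : eval_deg n 1 = if n is 0%N then 1 else 0.
Proof.
case: n => [|n] //=.
have E b : (fun w => (1 : ncs R) (b :: w)) = 0 :> ncs R by [].
by rewrite !E !eval_deg0 !mulr0 addr0.
Qed.

Lemma eval_deg_nvar n b : eval_deg n (nvar R b) = if n == 1%N then gen b else 0.
Proof.
case: n => [|n]; first by rewrite /= /nvar /nc_var /= raddf0.
have E c : (fun w => nvar R b (c :: w)) = (c == b)%:R *: 1 :> ncs R.
  apply/funext => w; rewrite ncs_scaleE /nvar /nc_var eqseq_cons -ncs_oneE /nc_one.
  by case: (c == b); rewrite ?mul1r ?mul0r.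
rewrite /= !E !eval_degZ eval_deg1 /gen; case: n => [|n] /=.
  by case: b {E}; rewrite /= ?scale1r ?scale0r ?mulr0 ?mulr1 ?add0r ?addr0.
by rewrite !scaler0 !mulr0 addr0.
Qed.

Fixpoint meval t : 'M[R]_2 :=
  match t with Gen b => gen b | Bracket t u => meval t * meval u - meval u * meval t end.

Lemma eval_deg_lm n t : eval_deg n (lm R t) = if n == (deg false t + deg true t)%N then meval t else 0.
Proof.
elim: t n => [b|t IHt u IHu] n.
  by rewrite [lm _ _]/(nvar R b) eval_deg_nvar; case: b.
have H t1 t2 : (forall n, eval_deg n (lm R t1) = if n == (deg false t1 + deg true t1)%N then meval t1 else 0) ->
   (forall n, eval_deg n (lm R t2) = if n == (deg false t2 + deg true t2)%N then meval t2 else 0) ->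
   eval_deg n (lm R t1 * lm R t2) =
     if n == (deg false t1 + deg true t1 + (deg false t2 + deg true t2))%N then meval t1 * meval t2 else 0.
  move=> H1 H2; rewrite eval_degM.
  set d1 := (deg false t1 + _)%N; set d2 := (deg false t2 + _)%N.
  have [hd|hd] := leqP d1 n; last first.
    rewrite big1 => [|i _]; last first.
      rewrite H1 (_ : (_ == _) = false) ?mul0r //; apply/eqP; have := ltn_ord i; lia.
    by case: eqP => // h; lia.
  rewrite (bigD1 (Ordinal (hd : (d1 < n.+1)%N))) //= big1 => [|i hi]; last first.
    rewrite H1 (_ : (_ == _) = false) ?mul0r //; apply: contraNF hi => /eqP hi.
    by apply/eqP/val_inj.
  rewrite H1 H2 eqxx addr0; have -> : (n - d1 == d2)%N = (n == d1 + d2)%N by lia.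
  by case: eqP; rewrite ?mulr0.
have e1 : (deg false t + deg true t + (deg false u + deg true u) =
    deg false (Bracket t u) + deg true (Bracket t u))%N by rewrite /=; lia.
have e2 : (deg false u + deg true u + (deg false t + deg true t) =
    deg false (Bracket t u) + deg true (Bracket t u))%N by rewrite /=; lia.
rewrite lm_bracket /ad eval_degB !H // e1 e2.
by case: eqP => _; rewrite ?subr0.
Qed.

(* The square of 2 sqrt (j^2 + k1^2 + k2^2), for M = j J + k1 K1 + k2 K2 in sl_2. *)
Definition nsq M : R := 4 * (M 0 0) ^+ 2 + 2 * (M 0 1) ^+ 2 + 2 * (M 1 0) ^+ 2.
Definition traceless M := M 1 1 = - M 0 0.

(* Lagrange's identity for the cross product structure of sl_2. *)
Lemma nsq_bracket M N : traceless M -> traceless N ->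
  traceless (M * N - N * M) /\ nsq (M * N - N * M) <= nsq M * nsq N.
Proof.
rewrite /traceless /nsq => hM hN.
have E i j : (M * N - N * M) i j = M i 0 * N 0 j + M i 1 * N 1 j - (N i 0 * M 0 j + N i 1 * M 1 j).
  by rewrite mxE [X in _ + X]mxE !mulmx2E.
rewrite !E hM hN; split; first by ring.
rewrite -subr_ge0.
rewrite [X in 0 <= X](_ : _ = 4 * (2 * M 0 0 * N 0 0 + M 0 1 * N 0 1 + M 1 0 * N 1 0) ^+ 2).
  by rewrite mulr_ge0 ?sqr_ge0.
ring.
Qed.

Lemma meval_bound x t : traceless A -> traceless B -> nsq A <= x ^+ 2 -> nsq B <= x ^+ 2 ->
  traceless (meval t) /\ nsq (meval t) <= (x ^+ (deg false t + deg true t)) ^+ 2.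
Proof.
move=> tA tB hA hB; elim: t => [b|t [tt IHt] u [tu IHu]]; first by case: b.
have [h1 h2] := nsq_bracket tt tu; split=> //=.
apply: le_trans h2 _; rewrite addnACA exprD exprMn; apply: ler_pM => //;
  by rewrite /nsq !addr_ge0 // mulr_ge0 ?sqr_ge0.
Qed.

Lemma entry_le_nsq M i j x : traceless M -> 0 <= x -> nsq M <= x ^+ 2 -> `|M i j| <= x.
Proof.
rewrite /traceless /nsq => tM x0 h.
rewrite -(@ler_pXn2r _ 2) ?nnegrE // real_normK ?num_real //.
have := (sqr_ge0 (M 0 0), sqr_ge0 (M 0 1), sqr_ge0 (M 1 0)) => -[[h1 h2] h3].
case: (ord2P i) => ->; case: (ord2P j) => ->; try lra.
rewrite tM sqrrN; lra.
Qed.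

End Evaluation.

(** * Summability of the evaluated BCH components *)

Section Summability.
Variables (R : realType) (A B : 'M[R]_2) (x : R).
Hypotheses (x0 : 0 < x) (tA : traceless A) (tB : traceless B).
Hypotheses (hA : nsq A <= x ^+ 2) (hB : nsq B <= x ^+ 2).

Let comp m n : ncs R := @BCH_comp R m n.

(** An arbitrary decomposition may contain monomials of other bidegrees, for which the bound x^(m+n)
    fails in general; discarding them changes nothing and only lowers the weight. *)
Lemma BCH_comp_bideg m n s : lie_decomposition (@BCH_comp R m n) s ->
  comp m n = \sum_(p <- bideg m n s) p.1 *: lm R p.2.
Proof.
move=> H; apply/funext => w; rewrite ncs_sumE /bideg big_filter.
have [/andP[/eqP hm /eqP hn]|hw] := boolP ((count_mem false w == m) && (count_mem true w == n)).
  rewrite /comp H [RHS]big_mkcond; apply: eq_bigr => p _; rewrite ncs_scaleE.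
  rewrite -[lie_monomial _ _]/(lm R p.2).
  case: ifP => // /negbT; rewrite negb_and => /orP[h|h].
    by rewrite (@lm_deg R _ false) ?mulr0 // hm eq_sym.
  by rewrite (@lm_deg R _ true) ?mulr0 // hn eq_sym.
rewrite /comp /BCH_comp (negbTE hw) big1 // => p /andP[/eqP h1 /eqP h2]; rewrite ncs_scaleE.
move: hw; rewrite negb_and -h1 -h2 => /orP[h|h].
  by rewrite (@lm_deg R _ false) ?mulr0.
by rewrite (@lm_deg R _ true) ?mulr0.
Qed.

Lemma eval_BCH_comp_le m n i j :
  (`|eval_deg A B (m + n) (comp m n) i j|%:E <= lie_norm (comp m n) * (x ^+ m * x ^+ n)%:E)%E.
Proof.
set e := `|_|; have xn : 0 < x ^+ (m + n) by rewrite exprn_gt0.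
have xn0 : x ^+ (m + n) != 0 by rewrite gt_eqF.
rewrite -exprD -(divfK xn0 e) EFinM; apply: lee_wpmul2r; first by rewrite lee_fin ltW.
apply: le_ereal_inf_tmp => _ [s hs <-]; rewrite lee_fin ler_pdivrMr //.
apply: (@le_trans _ _ (\sum_(p <- bideg m n s) `|p.1| * x ^+ (m + n))); last first.
  rewrite -mulr_suml ler_pM2r // /bideg big_filter [leRHS](bigID (fun p =>
    (deg false p.2 == m) && (deg true p.2 == n))) /=.
  by rewrite lerDl sumr_ge0.
rewrite /e (BCH_comp_bideg hs) eval_deg_sum summxE; apply: le_trans (ler_norm_sum _ _ _) _.
rewrite /bideg !big_filter; apply: ler_sum => p /andP[/eqP h1 /eqP h2].
rewrite eval_degZ mxE normrM ler_wpM2l // eval_deg_lm h1 h2 eqxx.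
have [tt bt] := meval_bound p.2 tA tB hA hB.
by apply: entry_le_nsq => //; [exact: ltW | rewrite -h1 -h2].
Qed.

Lemma eval_BCH_split n i j :
  `|eval_deg A B n (nBCH R) i j| <= \sum_(m < n.+1) `|eval_deg A B n (comp m (n - m)) i j|.
Proof.
have -> : eval_deg A B n (nBCH R) = \sum_(m < n.+1) eval_deg A B n (comp m (n - m)).
  rewrite -eval_deg_sum; apply: eval_deg_ext => w Hw; rewrite ncs_sumE.
  have hc := count_word_size w; rewrite Hw in hc.
  have hm : (count_mem false w < n.+1)%N by rewrite ltnS -hc leq_addr.
  rewrite (bigD1 (Ordinal hm)) //= big1 => [|k hk]; last first.
    rewrite /comp /BCH_comp (_ : (_ == _) = false) //; apply: contraNF hk => /eqP hk.
    by apply/eqP/val_inj.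
  rewrite addr0 /comp /BCH_comp eqxx -BCHE -hc addKn eqxx //.
by rewrite summxE; apply: ler_norm_sum.
Qed.

Lemma eval_BCH_summable : (GammaLie x x < +oo)%E ->
  exists2 G : R, 0 <= G & forall N i j, \sum_(n < N) `|eval_deg A B n (nBCH R) i j| <= G.
Proof.
move=> hG.
have G0 : (0 <= GammaLie x x)%E.
  apply: esum_ge0 => -[m n] _; apply: mule_ge0; first exact: lie_norm_ge0.
  by rewrite lee_fin mulr_ge0 ?exprn_ge0 // ltW.
have Gfin : GammaLie x x \is a fin_num by rewrite ge0_fin_numE.
exists (fine (GammaLie x x)); first exact: fine_ge0.
move=> N i j; rewrite -lee_fin fineK //.
pose b m n := `|eval_deg A B (m + n) (comp m n) i j|.
pose s := [seq p <- [seq (m, n) | m <- iota 0 N.+1, n <- iota 0 N.+1] | (0 < p.1 + p.2)%N].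
have us : uniq s.
  by rewrite filter_uniq // allpairs_uniq ?iota_uniq // => -[? ?] [? ?].
apply: (@le_trans _ _ (\sum_(p <- s) (b p.1 p.2)%:E)%E).
  rewrite sumEFin lee_fin.
  apply: (@le_trans _ _ (\sum_(n < N.+1) \sum_(m < n.+1) b m (n - m)%N)).
    rewrite big_ord_recr /= ler_wpDr //; first by apply: sumr_ge0 => m _; apply: normr_ge0.
    apply: ler_sum => n _; apply: le_trans (eval_BCH_split _ _ _) _.
    by apply: ler_sum => m _; rewrite /b subnKC // -ltnS.
  pose Y m n := if (m + n <= N)%N then b m n else 0.
  apply: (@le_trans _ _ (\sum_(m < N.+1) \sum_(n < N.+1) Y m n)).
    rewrite -(@tri_sum _ N Y); last first.
      by move=> m n h; rewrite /Y addnC leqNgt h.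
    rewrite le_eqVlt; apply/orP; left; apply/eqP; apply: eq_bigr => n _; apply: eq_bigr => m _.
    by rewrite /Y subnKC ?ifT // -ltnS.
  rewrite big_filter [leRHS]big_mkcond [leRHS]big_allpairs_dep /=.
  rewrite -(big_mkord predT (fun m => \sum_(n < N.+1) Y m n)) /index_iota subn0.
  apply: ler_sum => m _; rewrite -(big_mkord predT (Y m)) /index_iota subn0.
  apply: ler_sum => n _; rewrite /Y; case: posnP => h; last first.
    by case: ifP => // _; apply: normr_ge0.
  have [-> ->] : m = 0%N /\ n = 0%N by lia.
  (* [GammaLie] leaves out the bidegree (0, 0), but a logarithm has no constant term. *)
  have c0 : comp 0 0 [::] = 0 by rewrite /comp /BCH_comp /= /BCH /nc_log big_geq.
  by rewrite addn0 leq0n /b /= c0 raddf0 mxE normr0.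
apply: esum_ge; exists [set` s].
  split; first exact: finite_seq.
  by move=> p /=; rewrite mem_filter => /andP[].
rewrite -fsbig_seq //; apply: lee_sum => -[m n] _; exact: eval_BCH_comp_le.
Qed.

End Summability.

(** * The upper bound *)

Section Domination.
Variable R : realType.
Implicit Types P Q : {poly R}.

Definition dom P Q := forall n, `|P`_n| <= Q`_n.

Lemma dom_ge0 P Q n : dom P Q -> 0 <= Q`_n.
Proof. by move=> /(_ n); apply: le_trans. Qed.

Lemma domD P P' Q Q' : dom P Q -> dom P' Q' -> dom (P + P') (Q + Q').
Proof. by move=> h h' n; rewrite !coefD; apply: le_trans (ler_normD _ _) _; apply: lerD. Qed.

Lemma domN P Q : dom P Q -> dom (- P) Q.
Proof. by move=> h n; rewrite coefN normrN. Qed.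

Lemma domZ (c c' : R) P Q : `|c| <= c' -> dom P Q -> dom (c *: P) (c' *: Q).
Proof. by move=> hc h n; rewrite !coefZ normrM; apply: ler_pM. Qed.

Lemma domM P P' Q Q' : dom P Q -> dom P' Q' -> dom (P * P') (Q * Q').
Proof.
move=> h h' n; rewrite !coefM; apply: le_trans (ler_norm_sum _ _ _) _.
by apply: ler_sum => i _; rewrite normrM; apply: ler_pM.
Qed.

Lemma dom1 : dom 1 1.
Proof. by move=> n; rewrite !coef1 normr_nat. Qed.

Lemma domX P Q k : dom P Q -> dom (P ^+ k) (Q ^+ k).
Proof.
move=> h; elim: k => [|k IH]; first by rewrite !expr0; exact: dom1.
by rewrite !exprS; apply: domM.
Qed.

Lemma dom_sum m (F G : nat -> {poly R}) : (forall k, dom (F k) (G k)) ->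
  dom (\sum_(k < m) F k) (\sum_(k < m) G k).
Proof.
move=> h; elim: m => [|m IH]; first by rewrite !big_ord0 => n; rewrite coef0 normr0.
by rewrite !big_ord_recr; apply: domD.
Qed.

Lemma dom_sumS m (F G : nat -> {poly R}) : (forall k, dom (F k) (G k)) ->
  dom (\sum_(k < m) F k) (\sum_(k < m.+1) G k).
Proof.
move=> h; rewrite big_ord_recr /= -[X in dom X]addr0; apply: domD; first exact: dom_sum.
by move=> n; rewrite coef0 normr0; apply: dom_ge0 (h m).
Qed.

Lemma dom_poly m m' (a : nat -> R) : (m <= m')%N ->
  dom (\poly_(n < m) a n) (\poly_(n < m') `|a n|).
Proof.
move=> mm n; rewrite !coef_poly; case: ltnP => h; first by rewrite (leq_trans h mm).
by rewrite normr0; case: ifP.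
Qed.

Lemma horner1_sum P D : (size P <= D)%N -> P.[1] = \sum_(i < D) P`_i.
Proof.
move=> h; rewrite (horner_coef_wide _ h); apply: eq_bigr => i _.
by rewrite expr1n mulr1.
Qed.

(* N0 exceeds the degree of some Q N1 whose value at 1 is within e of the supremum:
   for N >= N0 the coefficients of Q N up to N already sum up to more than that value. *)
Lemma dom_tail_small (Q : nat -> {poly R}) (b e : R) :
  (forall N, dom (Q N) (Q N.+1)) -> (forall N, (Q N).[1] <= b) -> 0 < e ->
  exists N0, forall N, (N0 <= N)%N -> forall P, dom P (Q N) ->
    `|P.[1] - \sum_(n < N.+1) P`_n| <= e.
Proof.
move=> hQ hb e0.
have Q0 N n : 0 <= (Q N.+1)`_n by apply: dom_ge0 (hQ N).
have Qmono N M n : (N <= M)%N -> (Q N)`_n <= (Q M)`_n.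
  elim: M => [|M IH]; first by rewrite leqn0 => /eqP ->.
  rewrite leq_eqVlt => /orP[/eqP -> //|]; rewrite ltnS => /IH h.
  by apply: le_trans h _; apply: le_trans (ler_norm _) (hQ M n).
pose S := [set x | exists N, x = (Q N).[1]].
have hS : has_sup S.
  split; first by exists (Q 0%N).[1]; exists 0%N.
  by exists b => _ [N ->].
have [_ [N1 ->] h1] := sup_adherent e0 hS.
exists (maxn N1 (size (Q N1))) => N; rewrite geq_max => /andP[hN1 hsz] P hP.
pose D := maxn N.+1 (maxn (size P) (size (Q N))).
have hD : (N.+1 <= D)%N by rewrite leq_maxl.
have split_sum (f : nat -> R) : \sum_(i < D) f i = \sum_(i < N.+1) f i + \sum_(N.+1 <= i < D) f i.
  by rewrite -(big_mkord predT f) (big_cat_nat (n := N.+1)) //= big_mkord.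
rewrite (@horner1_sum P D); last by rewrite /D !leq_max leqnn orbT.
rewrite (split_sum (fun i => P`_i)) addrC addKr.
apply: (@le_trans _ _ (\sum_(N.+1 <= i < D) (Q N)`_i)).
  by apply: le_trans (ler_norm_sum _ _ _) _; apply: ler_sum => i _; apply: hP.
have -> : \sum_(N.+1 <= i < D) (Q N)`_i = (Q N).[1] - \sum_(i < N.+1) (Q N)`_i.
  rewrite (@horner1_sum (Q N) D); last by rewrite /D !leq_max leqnn !orbT.
  by rewrite (split_sum (fun i => (Q N)`_i)) addrC addKr.
have h2 : (Q N).[1] <= sup S by apply: ub_le_sup; [case: hS | exists N].
have h3 : (Q N1).[1] <= \sum_(i < N.+1) (Q N)`_i.
  rewrite (@horner1_sum (Q N1) N.+1); last exact: leq_trans hsz _.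
  by apply: ler_sum => i _; apply: Qmono.
lra.
Qed.

Lemma exp_sum_even_le (y : R) m : 0 <= y -> \sum_(k < m) y ^+ k.*2 / k.*2`!%:R <= expR y.
Proof.
move=> y0; apply: le_trans (exp_sum_le m.*2 y0).
rewrite (big_ord_double (fun k => y ^+ k / k`!%:R)); apply: ler_sum => k _.
by rewrite lerDl divr_ge0 ?exprn_ge0.
Qed.

Lemma exp_sum_odd_le (y : R) m : 0 <= y -> \sum_(k < m) y ^+ k.*2.+1 / k.*2.+1`!%:R <= expR y.
Proof.
move=> y0; apply: le_trans (exp_sum_le m.*2 y0).
rewrite (big_ord_double (fun k => y ^+ k / k`!%:R)); apply: ler_sum => k _.
by rewrite lerDr divr_ge0 ?exprn_ge0.
Qed.

(** u stands for det Z. For u >= 0 an odd number of Taylor terms lies above cos (sqrt u); for u < 0,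
    the hyperbolic case, all terms are nonnegative. *)
Lemma cos_sum_geN1 m (u : R) : odd m -> -1 <= cos_sum m u.
Proof.
move=> om; have [u0|u0] := leP 0 u.
  have := cos_le_sum (sqrtr_ge0 u) om; rewrite sqr_sqrtr //; apply: le_trans.
  exact: cos_geN1.
apply: (@le_trans _ _ 0); first by rewrite lerN10.
apply: sumr_ge0 => k _; rewrite mulrAC -exprMn mulN1r divr_ge0 ?exprn_ge0 //.
by rewrite oppr_ge0 ltW.
Qed.

End Domination.

(** * The trace of exp Z *)

Section TracePolynomials.
Variables (R : realType) (A B : 'M[R]_2).
Hypotheses (tA : traceless A) (tB : traceless B).

Let z n i j := eval_deg A B n (nBCH R) i j.

Lemma traceless_eval_BCH n : traceless (eval_deg A B n (nBCH R)).
Proof.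
have tm t : traceless (meval A B t).
  (* Any such y will do: only the tracelessness is taken from [meval_bound]. *)
  have [y [h1 h2]] : exists y, nsq A <= y ^+ 2 /\ nsq B <= y ^+ 2.
    have nA : 0 <= nsq A by rewrite /nsq !addr_ge0 // mulr_ge0 ?sqr_ge0.
    have nB : 0 <= nsq B by rewrite /nsq !addr_ge0 // mulr_ge0 ?sqr_ge0.
    by exists (nsq A + nsq B + 1); split; nra.
  by case: (meval_bound t tA tB h1 h2).
rewrite /traceless (@eval_deg_ext _ _ _ n _ (evl (BCHl R (n + n).+1 n))); last first.
  move=> w Hw; apply: (agree_BCHl R (ltnSn _));
    by rewrite -Hw -(count_word_size w) ?leq_addr ?leq_addl.
rewrite /evl eval_deg_sum !summxE -sumrN; apply: eq_bigr => p _.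
rewrite eval_degZ mxE [in RHS]mxE eval_deg_lm; case: ifP => _; last by rewrite !mxE mulr0 oppr0.
by rewrite (tm p.2) mulrN.
Qed.

Section Fixed.
Variable N : nat.

(** The indeterminate marks the degree, so the value at 1 is a partial sum of Z. *)
Definition BCH_mx : 'M[{poly R}]_2 := \matrix_(i, j) \poly_(n < N.+1) z n i j.

Lemma coef_mulmx (M M' : 'M[{poly R}]_2) n i j :
  ((M * M') i j)`_n = \sum_(k < n.+1) \sum_l (M i l)`_k * (M' l j)`_(n - k).
Proof.
by rewrite mxE coef_sum exchange_big; apply: eq_bigr => l _; rewrite coefM.
Qed.

Lemma coef_BCH_mx_exp k n i j : (n <= N)%N ->
  ((BCH_mx ^+ k) i j)`_n = eval_deg A B n (nBCH R ^+ k) i j.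
Proof.
elim: k n i j => [|k IH] n i j hn.
  rewrite !expr0 eval_deg1 mxE; case: n {hn} => [|n].
    by rewrite [in RHS]mxE; case: (i == j); rewrite ?coef1 ?coef0.
  by rewrite mxE; case: (i == j); rewrite ?coef1 ?coef0.
rewrite !exprS eval_degM coef_mulmx summxE; apply: eq_bigr => m _.
rewrite mxE; apply: eq_bigr => l _.
have hm : (m < N.+1)%N by apply: leq_trans (ltn_ord m) _.
rewrite IH; last by apply: leq_trans (leq_subr _ _) hn.
by rewrite mxE coef_poly hm.
Qed.

Definition BCH_det : {poly R} := - (BCH_mx 0 0 ^+ 2 + BCH_mx 0 1 * BCH_mx 1 0).

Lemma BCH_mx_traceless : BCH_mx 1 1 = - BCH_mx 0 0.
Proof.
apply/polyP => n; rewrite coefN !mxE !coef_poly; case: ifP => _; last by rewrite oppr0.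
exact: traceless_eval_BCH.
Qed.

Lemma BCH_mx_sqr : BCH_mx ^+ 2 = (- BCH_det)%:M.
Proof.
apply/matrixP => i j; rewrite expr2 mulmx2E [RHS]mxE /BCH_det opprK.
have e01 : (0 == 1 :> 'I_2) = false by []; have e10 : (1 == 0 :> 'I_2) = false by [].
case: (ord2P i) => ->; case: (ord2P j) => ->;
  rewrite ?BCH_mx_traceless ?e01 ?e10 ?eqxx ?mulr1n ?mulr0n; ring.
Qed.

Lemma tr_BCH_mx_even k : \tr (BCH_mx ^+ k.*2) = (- BCH_det) ^+ k *+ 2.
Proof.
rewrite -mul2n exprM BCH_mx_sqr -rmorphXn /= mxtrace_scalar //.
Qed.

Lemma tr_BCH_mx_odd k : \tr (BCH_mx ^+ k.*2.+1) = 0.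
Proof.
rewrite exprSr -mul2n exprM BCH_mx_sqr -rmorphXn /= -[_ * _]/(_ *m _) mul_scalar_mx.
by rewrite mxtraceZ mxtrace2 BCH_mx_traceless subrr mulr0.
Qed.

(** Since Z^2 = - det Z, odd powers have trace 0 and the trace of the truncated exponential is twice
    a Taylor polynomial of cos (sqrt (det Z)). *)
Definition BCH_trace_poly : {poly R} :=
  \sum_(k < N.+1) (2 * (k.*2`!%:R)^-1) *: (- BCH_det) ^+ k.

Lemma coef_BCH_trace_poly n : (n <= N)%N ->
  BCH_trace_poly`_n = \tr (eval_deg A B n (nexp (nBCH R))).
Proof.
move=> hn.
have -> : eval_deg A B n (nexp (nBCH R)) =
    \sum_(k < N.+1.*2) (k`!%:R)^-1 *: eval_deg A B n (nBCH R ^+ k).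
  (* Exactly 2 N + 2 terms, which pair up into N + 1 even and N + 1 odd powers. *)
  rewrite (@eval_deg_ext _ _ _ n _ (expt N.*2.+1 (nBCH R))); last first.
    move=> w Hw; apply: (@exp_eqm _ _ n); [exact: low_nBCH | | by rewrite Hw].
    by rewrite -addnn; apply: leq_trans hn _; lia.
  by rewrite /expt eval_deg_sum; apply: eq_bigr => k _; rewrite eval_degZ.
have tr k : \tr (eval_deg A B n (nBCH R ^+ k)) = (\tr (BCH_mx ^+ k))`_n.
  by rewrite !mxtrace2 coefD !coef_BCH_mx_exp.
rewrite raddf_sum /= (eq_bigr (fun k : 'I_ _ => (k`!%:R)^-1 * (\tr (BCH_mx ^+ k))`_n)); last first.
  by move=> k _; rewrite mxtraceZ tr.
rewrite (big_ord_double (fun k => (k`!%:R)^-1 * (\tr (BCH_mx ^+ k))`_n)).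
rewrite /BCH_trace_poly coef_sum; apply: eq_bigr => k _.
rewrite tr_BCH_mx_even tr_BCH_mx_odd coef0 mulr0 addr0 coefZ coefMn.
by rewrite -mulr_natr; ring.
Qed.

Lemma horner_BCH_trace_poly : BCH_trace_poly.[1] = 2 * cos_sum N.+1 BCH_det.[1].
Proof.
rewrite /BCH_trace_poly horner_sum /cos_sum mulr_sumr; apply: eq_bigr => k _.
rewrite hornerZ horner_exp hornerN -[- _]mulN1r exprMn; ring.
Qed.

Let absp i j : {poly R} := \poly_(n < N.+1) `|z n i j|.

Definition BCH_trace_maj : {poly R} := \sum_(k < N.+1) (2 * (k.*2`!%:R)^-1) *:
   (absp 0 0 ^+ 2 + absp 0 1 * absp 1 0) ^+ k.

Lemma dom_BCH_trace_poly : dom BCH_trace_poly BCH_trace_maj.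
Proof.
apply: (@dom_sum _ _ (fun k => (2 * (k.*2`!%:R)^-1) *: (- BCH_det) ^+ k)
   (fun k => (2 * (k.*2`!%:R)^-1) *: (absp 0 0 ^+ 2 + absp 0 1 * absp 1 0) ^+ k)) => k.
apply: domZ; first by rewrite ger0_norm // mulr_ge0 ?invr_ge0.
have da i j : dom (BCH_mx i j) (absp i j) by rewrite mxE; apply: dom_poly.
by apply: domX; apply/domN/domN/domD; [apply: domX | apply: domM].
Qed.

(** With entries bounded by G, a^2 + b c <= 2 G^2 <= (2 G)^2, which leaves even terms of the series
    of exp (2 G). *)
Lemma horner_BCH_trace_maj G : 0 <= G ->
  (forall N i j, \sum_(n < N) `|z n i j| <= G) -> BCH_trace_maj.[1] <= 2 * expR (2 * G).
Proof.
move=> G0 hG.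
have ha i j : 0 <= (absp i j).[1] <= G.
  rewrite (@horner1_sum _ _ N.+1) ?size_poly //.
  rewrite (eq_bigr (fun n : 'I_N.+1 => `|z n i j|)); last by move=> n _; rewrite coef_poly ltn_ord.
  by rewrite hG sumr_ge0.
rewrite /BCH_trace_maj horner_sum.
have G20 : 0 <= 2 * G by rewrite mulr_ge0.
apply: (@le_trans _ _ (2 * \sum_(k < N.+1) (2 * G) ^+ k.*2 / k.*2`!%:R)); last first.
  by rewrite ler_pM2l //; apply: exp_sum_even_le.
rewrite mulr_sumr; apply: ler_sum => k _.
rewrite hornerZ -mulrA ler_pM2l // mulrC ler_pM2r ?invr_gt0 ?ltr0n ?fact_gt0 //.
rewrite -mul2n exprM horner_exp hornerD horner_exp hornerM.
have /andP[a0 a1] := ha 0 0; have /andP[b0 b1] := ha 0 1; have /andP[c0 c1] := ha 1 0.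
apply: lerXn2r; rewrite ?nnegrE ?sqr_ge0 ?addr_ge0 ?sqr_ge0 ?mulr_ge0 //.
move: a0 a1 b0 b1 c0 c1; move: (absp 0 0).[1] (absp 0 1).[1] (absp 1 0).[1] => a b c *; nra.
Qed.

End Fixed.

Lemma BCH_trace_maj_mono N : dom (BCH_trace_maj N) (BCH_trace_maj N.+1).
Proof.
pose ap M i j : {poly R} := \poly_(n < M.+1) `|z n i j|.
pose F M k := (2 * (k.*2`!%:R)^-1) *: (ap M 0 0 ^+ 2 + ap M 0 1 * ap M 1 0) ^+ k.
have h k : dom (F N k) (F N.+1 k).
  apply: domZ; first by rewrite ger0_norm // mulr_ge0 ?invr_ge0.
  have da i j : dom (ap N i j) (ap N.+1 i j).
    move=> n; rewrite !coef_poly; case: ltnP => hn; first by rewrite (leq_trans hn (leqnSn _)) normr_id.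
    by rewrite normr0; case: ifP.
  by apply: domX; apply: domD; [apply: domX | apply: domM].
exact: (dom_sumS N.+1 h).
Qed.

End TracePolynomials.

(** * The trace of exp A exp B *)

Section ExponentialTrace.
Variables (R : realType) (A B : 'M[R]_2) (w : R).
Hypotheses (tA : traceless A) (tB : traceless B).
Hypotheses (sqA : A ^+ 2 = (- w ^+ 2)%:M) (sqB : B ^+ 2 = (- w ^+ 2)%:M).

Let gen (b : bool) := if b then B else A.

Lemma eval_deg_nvarX n k b :
  eval_deg A B n (nvar R b ^+ k) = if n == k then gen b ^+ k else 0.
Proof.
elim: k n => [|k IH] n; first by rewrite !expr0 eval_deg1; case: n.
rewrite exprS eval_degM; case: n => [|n].
  by rewrite big_ord1 eval_deg_nvar /= mul0r.
rewrite big_ord_recl eval_deg_nvar mul0r add0r big_ord_recl big1 => [|i _]; last first.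
  by rewrite !lift0 eval_deg_nvar mul0r.
rewrite addr0 lift0 eval_deg_nvar /= IH subSS subn0 eqSS; case: eqP => _; rewrite ?exprS ?mulr0 //.
Qed.

Lemma eval_deg_exp n b : eval_deg A B n (nexp (nvar R b)) = (n`!%:R)^-1 *: gen b ^+ n.
Proof.
rewrite (@eval_deg_ext _ _ _ n _ (expt n (nvar R b))); last first.
  by move=> u Hu; apply: (@exp_eqm _ _ n); [exact: low_nvar | | rewrite Hu].
rewrite /expt eval_deg_sum big_ord_recr /= eval_degZ eval_deg_nvarX eqxx big1 ?add0r // => k _.
rewrite eval_degZ eval_deg_nvarX (_ : (n == k) = false) ?scaler0 //.
by apply/eqP; have := ltn_ord k; lia.
Qed.

Let cc n : R := if odd n then 0 else (- w ^+ 2) ^+ n./2 / n`!%:R.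
Let ss n : R := if odd n then (- w ^+ 2) ^+ n./2 / n`!%:R else 0.

Lemma exp_term_split M n : M ^+ 2 = (- w ^+ 2)%:M ->
  (n`!%:R)^-1 *: M ^+ n = (cc n)%:M + ss n *: M :> 'M[R]_2.
Proof.
move=> hM; have [m [->|->]] : exists m, n = m.*2 \/ n = m.*2.+1.
- by exists n./2; rewrite -{1 3}(odd_double_half n); case: (odd n); [right | left].
- rewrite /cc /ss odd_double doubleK scale0r addr0 -mul2n exprM hM -rmorphXn /=.
  by rewrite scale_scalar_mx mulrC.
- rewrite /cc /ss oddS odd_double /= uphalf_double raddf0 add0r exprSr -mul2n exprM hM -rmorphXn /=.
  by rewrite -[_ * M]/(_ *m M) mul_scalar_mx scalerA mulrC.
Qed.

Definition cosp N : {poly R} := \poly_(n < N.+1.*2) cc n.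
Definition sinp N : {poly R} := \poly_(n < N.+1.*2) ss n.

(** If A^2 = B^2 = - w^2, then exp (t A) = c(t) + s(t) A with c(1) = cos w and s(1) = sin w / w, and
    likewise for B. In the trace of the product the mixed terms vanish, A and B being traceless. *)
Definition prod_trace_poly N : {poly R} := 2 *: cosp N ^+ 2 + \tr (A * B) *: sinp N ^+ 2.

Lemma coef_prod_trace_poly N n : (n <= N)%N ->
  (prod_trace_poly N)`_n = \tr (eval_deg A B n (nexp (nBCH R))).
Proof.
move=> hn; rewrite nexp_nBCH eval_degM raddf_sum /prod_trace_poly coefD !coefZ !expr2 !coefM.
rewrite !mulr_sumr -big_split; apply: eq_bigr => i _ /=.
have h1 : (i < N.+1.*2)%N by rewrite -addnn; apply: leq_trans (ltn_ord i) _; lia.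
have h2 : (n - i < N.+1.*2)%N by rewrite -addnn; apply: leq_trans (_ : N.+1 <= _)%N; lia.
rewrite !coef_poly h1 h2 !eval_deg_exp /gen !exp_term_split //.
move: (cc i) (cc (n - i)) (ss i) (ss (n - i)) => c c' s s'.
rewrite !mxtrace2 !mulmx2E !mxE /= !mulr1n !mulr0n tA tB; ring.
Qed.

Lemma horner_cosp N : (cosp N).[1] = cos_sum N.+1 (w ^+ 2).
Proof.
rewrite (@horner1_sum _ _ N.+1.*2) ?size_poly //.
rewrite (big_ord_double (fun i => (cosp N)`_i)); apply: eq_bigr => k _.
have hk : (k.*2.+1 < N.+1.*2)%N by have := ltn_ord k; lia.
rewrite !coef_poly hk (ltnW hk) /cc oddS odd_double /= doubleK addr0.
by rewrite -[- w ^+ 2]mulN1r exprMn; ring.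
Qed.

Lemma horner_sinp N : (sinp N).[1] * w = \sum_(k < N.+1) (-1) ^+ k * w ^+ k.*2.+1 / k.*2.+1`!%:R.
Proof.
rewrite (@horner1_sum _ _ N.+1.*2) ?size_poly //.
rewrite (big_ord_double (fun i => (sinp N)`_i)) mulr_suml; apply: eq_bigr => k _.
have hk : (k.*2.+1 < N.+1.*2)%N by have := ltn_ord k; lia.
rewrite !coef_poly hk (ltnW hk) /ss oddS odd_double /= uphalf_double add0r.
by rewrite -[- w ^+ 2]mulN1r exprMn (exprSr w k.*2) -(mul2n k) exprM; ring.
Qed.

Let acosp N : {poly R} := \poly_(n < N.+1.*2) `|cc n|.
Let asinp N : {poly R} := \poly_(n < N.+1.*2) `|ss n|.
Definition prod_trace_maj N : {poly R} := 2 *: acosp N ^+ 2 + `|\tr (A * B)| *: asinp N ^+ 2.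

Lemma dom_prod_trace_poly N : dom (prod_trace_poly N) (prod_trace_maj N).
Proof.
apply: domD; apply: domZ => //; first by rewrite ger0_norm.
  by apply: domX; apply: dom_poly.
by apply: domX; apply: dom_poly.
Qed.

Lemma prod_trace_maj_mono N : dom (prod_trace_maj N) (prod_trace_maj N.+1).
Proof.
have h (a : nat -> R) : dom (\poly_(n < N.+1.*2) `|a n|) (\poly_(n < N.+2.*2) `|a n|).
  have hN : (N.+1.*2 <= N.+2.*2)%N by lia.
  move=> n; rewrite !coef_poly; case: ltnP => hn; first by rewrite (leq_trans hn hN) normr_id.
  by rewrite normr0; case: ifP.
apply: domD; apply: domZ; rewrite ?normr_id //; first by rewrite ger0_norm.
  exact/domX/h.
exact/domX/h.
Qed.

Lemma horner_prod_trace_maj N : 0 < w ->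
  (prod_trace_maj N).[1] <= 2 * expR w ^+ 2 + `|\tr (A * B)| * (expR w / w) ^+ 2.
Proof.
move=> w0; rewrite /prod_trace_maj hornerD !hornerZ !horner_exp.
have hc : 0 <= (acosp N).[1] <= expR w.
  rewrite (@horner1_sum _ _ N.+1.*2) ?size_poly //.
  rewrite sumr_ge0 /=; last by move=> i _; rewrite coef_poly; case: ifP.
  apply: le_trans (exp_sum_even_le N.+1 (ltW w0)).
  rewrite (big_ord_double (fun i => (acosp N)`_i)); apply: ler_sum => k _.
  have hk : (k.*2.+1 < N.+1.*2)%N by have := ltn_ord k; lia.
  rewrite !coef_poly hk (ltnW hk) /cc oddS odd_double /= doubleK normr0 addr0.
  by rewrite normrM normfV normr_nat normrX normrN normrX (gtr0_norm w0) -mul2n exprM.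
have hs : 0 <= (asinp N).[1] <= expR w / w.
  rewrite (@horner1_sum _ _ N.+1.*2) ?size_poly //.
  rewrite sumr_ge0 /=; last by move=> i _; rewrite coef_poly; case: ifP.
  rewrite ler_pdivlMr //; apply: le_trans (exp_sum_odd_le N.+1 (ltW w0)).
  rewrite (big_ord_double (fun i => (asinp N)`_i)) mulr_suml; apply: ler_sum => k _.
  have hk : (k.*2.+1 < N.+1.*2)%N by have := ltn_ord k; lia.
  rewrite !coef_poly hk (ltnW hk) /ss oddS odd_double /= uphalf_double normr0 add0r.
  rewrite normrM normfV normr_nat normrX normrN normrX (gtr0_norm w0) (exprSr w k.*2) -mul2n exprM.
  by rewrite mulrAC.
case/andP: hc => hc0 hc1; case/andP: hs => hs0 hs1.
apply: lerD; apply: ler_wpM2l => //; apply: lerXn2r => //; rewrite nnegrE.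
  exact: expR_ge0.
by rewrite divr_ge0 ?expR_ge0 // ltW.
Qed.

Lemma cvg_prod_trace_poly : 0 < w ->
  (prod_trace_poly N).[1] @[N --> \oo] --> 2 * cos w ^+ 2 + \tr (A * B) * (sin w / w) ^+ 2.
Proof.
move=> w0.
have hc : (cosp N).[1] @[N --> \oo] --> cos w.
  rewrite (_ : (fun N => (cosp N).[1]) = (fun N => series (cos_coeff' w) N.+1)); last first.
    apply/funext => N; rewrite horner_cosp /cos_sum /series /= big_mkord; apply: eq_bigr => k _.
    by rewrite /cos_coeff' -mul2n exprM exprnP mulrAC.
  by rewrite cvg_shiftS; exact: cvg_cos_coeff'.
have hs : (sinp N).[1] @[N --> \oo] --> sin w / w.
  rewrite (_ : (fun N => (sinp N).[1]) = (fun N => series (sin_coeff' w) N.+1 / w)); last first.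
    apply/funext => N; rewrite -[LHS](mulfK (lt0r_neq0 w0)) horner_sinp; congr (_ / _).
    by rewrite /series /= big_mkord.
  apply: cvgM; last exact: cvg_cst.
  by rewrite (cvg_shiftS (series (sin_coeff' w))); exact: cvg_sin_coeff'.
rewrite (_ : (fun N => (prod_trace_poly N).[1]) =
  (fun N => 2 * ((cosp N).[1] * (cosp N).[1]) + \tr (A * B) * ((sinp N).[1] * (sinp N).[1]))).
  rewrite !expr2; apply: cvgD; apply: cvgM; try exact: cvg_cst; exact: cvgM.
by apply/funext => N; rewrite /prod_trace_poly hornerD !hornerZ !horner_exp !expr2.
Qed.

End ExponentialTrace.

Section UpperBound.
Variable R : realType.

(* The exponential of a real traceless 2 x 2 matrix has trace at least -2. *)
Lemma GammaLie_infinite (A B : 'M[R]_2) (x w : R) : 0 < x -> 0 < w ->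
  traceless A -> traceless B -> nsq A <= x ^+ 2 -> nsq B <= x ^+ 2 ->
  A ^+ 2 = (- w ^+ 2)%:M -> B ^+ 2 = (- w ^+ 2)%:M ->
  2 * cos w ^+ 2 + \tr (A * B) * (sin w / w) ^+ 2 < - 2 ->
  ~ (GammaLie x x < +oo)%E.
Proof.
move=> x0 w0 tA tB hA hB sA sB; set L := _ + _ => hL hG.
have [G G0 hsum] := eval_BCH_summable x0 tA tB hA hB hG.
(* The gap -2 - L is 4 e, while three errors of size e are made: the two tails and the distance to
   the limit L. *)
pose e := (- 2 - L) / 4; have e0 : 0 < e by rewrite /e; lra.
have [N1 h1] := dom_tail_small (@BCH_trace_maj_mono R A B)
  (fun N => horner_BCH_trace_maj N G0 hsum) e0.
have [N2 h2] := dom_tail_small (@prod_trace_maj_mono R A B w)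
  (fun N => @horner_prod_trace_maj R A B w N w0) e0.
have := @cvg_prod_trace_poly R A B w w0; rewrite -/L.
move/cvgrPdist_lt => /(_ _ e0) [N3 _ h3].
(* N is even because [cos_sum_geN1] needs an odd number N + 1 of terms. *)
pose N := (N1 + N2 + N3).*2.
have n1 : (N1 <= N)%N by rewrite /N -addnn; lia.
have n2 : (N2 <= N)%N by rewrite /N -addnn; lia.
have n3 : (N3 <= N)%N by rewrite /N -addnn; lia.
have {h1} := h1 N n1 _ (dom_BCH_trace_poly A B N).
have {h2} := h2 N n2 _ (dom_prod_trace_poly A B w N).
have {h3} := h3 N n3.
(* Up to degree N both polynomials carry the trace of exp Z = exp X exp Y. *)
have -> : \sum_(n < N.+1) (BCH_trace_poly A B N)`_n = \sum_(n < N.+1) (prod_trace_poly A B w N)`_n.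
  apply: eq_bigr => n _; rewrite coef_BCH_trace_poly //; last by rewrite -ltnS.
  by rewrite coef_prod_trace_poly // -ltnS.
rewrite horner_BCH_trace_poly.
have hc : -1 <= cos_sum N.+1 (BCH_det A B N).[1].
  by apply: cos_sum_geN1; rewrite oddS odd_double.
move: hc; set c := cos_sum _ _; set S := \sum_(_ < _) _; set p := (prod_trace_poly _ _ _ _).[1].
clearbody c S p => hc.
rewrite ltr_distl !ler_distl => /andP[? ?] /andP[? ?] /andP[? ?].
have : e * 4 = - 2 - L by rewrite /e divfK.
lra.
Qed.

Definition sl2_mx (p q r : R) : 'M[R]_2 :=
  \matrix_(i, j) (if i == 0 then (if j == 0 then p else q) else (if j == 0 then r else - p)).

Lemma sl2_mxE p q r : [/\ sl2_mx p q r 0 0 = p, sl2_mx p q r 0 1 = q,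
  sl2_mx p q r 1 0 = r & sl2_mx p q r 1 1 = - p].
Proof. by split; rewrite mxE. Qed.

Lemma GammaLie_infinite_Mi (d x : R) : 0 < d < 1 -> Mi_fun d < x -> ~ (GammaLie x x < +oo)%E.
Proof.
move=> d01 hx; have [a0 api ca] := acos_itv d01.
case/andP: d01 => d0 d1.
have hd : 0 < 1 - d ^+ 2 by rewrite subr_gt0 exprn_ilt1 // ltW.
have hd' : 0 < 1 + d ^+ 2 by rewrite ltr_pwDl // sqr_ge0.
pose m := Num.sqrt (1 - d ^+ 2); pose n := Num.sqrt (1 + d ^+ 2).
have m0 : 0 < m by rewrite sqrtr_gt0.
have n0 : 0 < n by rewrite sqrtr_gt0.
have m2 : m ^+ 2 = 1 - d ^+ 2 by rewrite sqr_sqrtr // ltW.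
have n2 : n ^+ 2 = 1 + d ^+ 2 by rewrite sqr_sqrtr // ltW.
have hM : Mi_fun d = acos d / m * (2 * n) by [].
(* The first argument keeps the norm 2 n s of A and B below x; the second keeps s m in [0, pi / 2],
   so that 0 <= cos (s m) < d. *)
pose s := Num.min (x / (2 * n)) (pi / 2 / m).
have sx : 2 * n * s <= x.
  by rewrite mulrC -ler_pdivlMr ?mulr_gt0 // ge_min lexx.
have sp : s * m <= pi / 2 by rewrite -ler_pdivlMr // ge_min lexx orbT.
have sa : acos d < s * m.
  rewrite -ltr_pdivrMr // lt_min; apply/andP; split.
    by rewrite ltr_pdivlMr ?mulr_gt0 // -hM.
  by rewrite ltr_pM2r ?invr_gt0.
have w0 : 0 < s * m by apply: lt_trans sa.
have s0 : 0 < s by rewrite -(pmulr_lgt0 _ m0).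
have x0 : 0 < x by apply: lt_le_trans sx; rewrite !mulr_gt0.
have cw : cos (s * m) ^+ 2 < d ^+ 2.
  have hpi := @pi_gt0 R.
  have c1 : 0 <= cos (s * m) by apply: cos_ge0_pihalf; apply/andP; split; lra.
  have c2 : cos (s * m) < d.
    have i1 : acos d \in `[0, pi]%R by rewrite in_itv /=; apply/andP; split; lra.
    have i2 : s * m \in `[0, pi]%R by rewrite in_itv /=; apply/andP; split; lra.
    by have := ltr_cos i1 i2; rewrite ca sa => ->.
  by rewrite ltr_pXn2r // nnegrE // ltW.
(* A = s (J + d K1) and B = s (J - d K1), where J = [0, -1; 1, 0] and K1 = diag (1, -1). *)
pose A := sl2_mx (s * d) (- s) s; pose B := sl2_mx (- (s * d)) (- s) s.
have [A00 A01 A10 A11] := sl2_mxE (s * d) (- s) s.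
have [B00 B01 B10 B11] := sl2_mxE (- (s * d)) (- s) s.
have x2 : 4 * (1 + d ^+ 2) * s ^+ 2 <= x ^+ 2.
  rewrite -n2 (_ : _ * _ = (2 * n * s) ^+ 2); last by ring.
  by rewrite lerXn2r // nnegrE ?ltW // !mulr_gt0.
have e01 : (0 == 1 :> 'I_2) = false by []. have e10 : (1 == 0 :> 'I_2) = false by [].
have sq (p q r : R) : p ^+ 2 + q * r = - (s * m) ^+ 2 -> sl2_mx p q r ^+ 2 = (- (s * m) ^+ 2)%:M.
  move=> h; have [h00 h01 h10 h11] := sl2_mxE p q r.
  apply/matrixP => i j; rewrite expr2 mulmx2E [RHS]mxE -h.
  case: (ord2P i) => ->; case: (ord2P j) => ->;
    rewrite ?h00 ?h01 ?h10 ?h11 ?e01 ?e10 ?eqxx ?mulr1n ?mulr0n; ring.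
apply: (@GammaLie_infinite A B x (s * m)) => //.
- by rewrite /traceless A11 A00.
- by rewrite /traceless B11 B00.
- by rewrite /nsq A00 A01 A10; apply: le_trans x2; rewrite le_eqVlt; apply/orP; left; apply/eqP; ring.
- by rewrite /nsq B00 B01 B10; apply: le_trans x2; rewrite le_eqVlt; apply/orP; left; apply/eqP; ring.
- by apply: sq; rewrite [(s * m) ^+ 2]exprMn m2; ring.
- by apply: sq; rewrite [(s * m) ^+ 2]exprMn m2; ring.
rewrite mxtrace2 !mulmx2E A00 A01 A10 A11 B00 B01 B10 B11 expr_div_n sin2cos2.
rewrite [(s * m) ^+ 2]exprMn m2; move: cw; move: (cos _ ^+ 2) => c cw.
have E : (1 - c) / (s ^+ 2 * (1 - d ^+ 2)) * (s ^+ 2 * (1 - d ^+ 2)) = 1 - c.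
  by rewrite divfK // gt_eqF // mulr_gt0 // exprn_gt0.
rewrite -(@ltr_pM2r _ (1 - d ^+ 2)) //.
have s20 : s != 0 by rewrite gt_eqF.
have hd0 : 1 - d ^+ 2 != 0 by rewrite gt_eqF.
(* Here tr (A B) = - 2 s^2 (1 + d^2). The right-hand side is 4 c - 2 - 2 d^2, which is below -2 (1 -
   d^2) exactly when c < d^2. *)
rewrite [X in X < _](_ : _ = 2 * c * (1 - d ^+ 2) - 2 * (1 + d ^+ 2) * (1 - c)); first nra.
by field; rewrite s20 hd0.
Qed.

Lemma C2Lie_le : (C2Lie R <= (2 * v_Mi R)%:E)%E.
Proof.
apply: ge_ereal_sup => _ [x [x0 hx] <-]; rewrite lee_fin leNgt; apply/negP => h.
have [[d [d01 hd]] _] := v_Mi_facts R.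
apply: (@GammaLie_infinite_Mi d (x / 2) d01); first by rewrite hd; lra.
(* The midpoint of the segment x1 + x2 = x is among the points over which the supremum is taken. *)
apply: le_lt_trans hx; apply: ereal_sup_ubound; exists (x / 2, x / 2) => //=.
by split; rewrite ?divr_ge0 //; lra.
Qed.

End UpperBound.

(* The second conjunct says that the infimum v_Mi is a minimum; the last one is
   5.4028570 <= 2 v_Mi < 5.4028571. *)
Theorem mainTheorem2 (R : realType) :
  [/\ ((293 / 100)%:E < C2Lie R <= (2 * v_Mi R)%:E)%E,
      exists d : R, 0 < d < 1 /\ Mi_fun d = v_Mi R
    & 5 + 402 / 10 ^+ 3 + 857 / 10 ^+ 6 <= 2 * v_Mi R
      < 5 + 402 / 10 ^+ 3 + 857 / 10 ^+ 6 + 1 / 10 ^+ 7].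
Proof.
by have [h1 h2] := v_Mi_facts R; split => //; rewrite C2Lie_gt C2Lie_le.
Qed.
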